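(* Let $m,n\in\mathbb{N}$ and let $\psi:\mathbb{F}[X]^m\to\{k^r:r\in\mathbb{Z}\}\cup\{0\}$ be bounded, with $\psi(\mathbf{q})>0$ for infinitely many $\mathbf{q}$. Then $$\dim_H\mathcal{W}(m,n;\psi)=n(m-1)+\min\{\eta(\psi),n\}.$$
   Context: $\mathbb{F}$ is a finite field with $k$ elements; $\mathbb{F}((X^{-1}))$ is the field of formal Laurent series in $X^{-1}$ over $\mathbb{F}$ with absolute value $|f|=k^{\deg f}$ ($|0|=0$), where the degree of a nonzero Laurent series is the largest exponent of $X$ with nonzero coefficient. On vectors, $|\mathbf{x}|_\infty=\max_i|x_i|$; matrices in $\mathrm{Mat}_{m\times n}(\mathbb{F}((X^{-1})))$ are identified with vectors in $\mathbb{F}((X^{-1}))^{mn}$. For $\mathbf{v}\in\mathbb{F}((X^{-1}))^n$, $\|\mathbf{v}\|$ is the $|\cdot|_\infty$-distance from $\mathbf{v}$ to $\mathbb{F}[X]^n$. $$\mathcal{W}(m,n;\psi)=\{A\in\mathrm{Mat}_{m\times n}(\mathbb{F}((X^{-1}))):\|\mathbf{q}A\|<\psi(\mathbf{q})\text{ for infinitely many }\mathbf{q}\in\mathbb{F}[X]^m\}.$$ $\eta(\psi)=\inf\{\eta\in\mathbb{R}:\sum_{\mathbf{q}\in\mathbb{F}[X]^m\setminus\{0\}}|\mathbf{q}|_\infty^n(\psi(\mathbf{q})/|\mathbf{q}|_\infty)^\eta<\infty\}$. $\dim_H$ is Hausdorff dimension (with respect to the metric from $|\cdot|_\infty$). 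*)

(* Defs.v *)
From HB Require Import structures.
From mathcomp Require Import all_boot all_order all_algebra all_field.
From mathcomp Require Import all_classical all_reals all_analysis.
Set Implicit Arguments. Unset Strict Implicit. Unset Printing Implicit Defensive.
Import Order.TTheory GRing.Theory Num.Theory.
Local Open Scope classical_set_scope.
Local Open Scope ring_scope.

Section Hausdorff.
Variables (R : realType) (T : Type) (d : T -> T -> R).

(* diameter (extended real; -oo for the empty set, +oo if unbounded) *)
Definition diamE (U : set T) : \bar R :=
  ereal_sup [set (d x y)%:E | x in U & y in U].

Definition hterm (s : R) (U : set T) : \bar R :=
  if `[< U = set0 >] then 0%E else ((fine (diamE U)) `^ s)%:E.

Definition Hcontent (delta s : R) (E : set T) : \bar R :=
  ereal_inf [set (\sum_(0 <= i <oo) hterm s (U i))%E |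
    U in [set U : nat -> set T |
            E `<=` \bigcup_i U i /\ forall i, (diamE (U i) <= delta%:E)%E]].

(* s-dimensional Hausdorff measure: lim_{delta -> 0+} = sup_{delta > 0} *)
Definition Hmeasure (s : R) (E : set T) : \bar R :=
  ereal_sup [set Hcontent delta s E | delta in [set delta : R | 0 < delta]].

Definition dimH (E : set T) : \bar R :=
  ereal_inf [set s%:E | s in [set s : R | 0 <= s /\ Hmeasure s E = 0%E]].
End Hausdorff.

Section Laurent.
Variables (F : finFieldType) (R : realType).

(* a formal Laurent series in X^-1: coefficient of X^t, t : int, vanishing
   for all sufficiently large t *)
Definition is_laurent (f : int -> F) : Prop :=
  exists N : int, forall t : int, N < t -> f t = 0.
Definition laurent := {f : int -> F | is_laurent f}.

Definition kF : R := (#|F|)%:R.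

(* |f| = k^(deg f), |0| = 0 ; deg f = largest t with nonzero coefficient *)
Definition absL (f : int -> F) : R :=
  sup [set kF ^ t | t in [set t : int | f t != 0]].

Definition normInf (n : nat) (v : 'I_n -> int -> F) : R :=
  \big[Num.max/0]_(j < n) absL (v j).

Definition polyL (p : {poly F}) : int -> F :=
  fun t => match t with Posz e => p`_e | Negz _ => 0 end.

Definition distZ (n : nat) (v : 'I_n -> int -> F) : R :=
  inf [set normInf (fun j t => v j t - polyL (p j) t) | p in [set: 'I_n -> {poly F}]].

Definition normP (m : nat) (q : 'rV[{poly F}]_m) : R :=
  \big[Num.max/0]_(i < m) absL (polyL (q ord0 i)).

Definition qmul (m n : nat) (q : 'rV[{poly F}]_m) (A : 'I_m -> 'I_n -> laurent)
  : 'I_n -> int -> F :=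
  fun j t => \sum_(i < m) \sum_(e < size (q ord0 i))
                (q ord0 i)`_e * sval (A i j) (t - e%:Z).

Definition distM (m n : nat) (A B : 'I_m -> 'I_n -> laurent) : R :=
  \big[Num.max/0]_(i < m) \big[Num.max/0]_(j < n)
     absL (fun t => sval (A i j) t - sval (B i j) t).

Definition Wset (m n : nat) (psi : 'rV[{poly F}]_m -> R)
  : set ('I_m -> 'I_n -> laurent) :=
  [set A | ~ finite_set [set q | distZ (qmul q A) < psi q]].

Definition eta_psi (m n : nat) (psi : 'rV[{poly F}]_m -> R) : R :=
  inf [set e : R |
    (\esum_(q in [set q : 'rV[{poly F}]_m | q != 0%R])
        (normP q ^+ n * (psi q / normP q) `^ e)%:E < +oo)%E].
End Laurent.

(* Main.v *)
(** Upper bound.  Let [|q| = k^d], [psi q = k^-r] and [L = d + r].  In a bounded box the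
    matrices [A] with [||qA|| < psi q] are covered by [C |q|^n k^(L n (m-1))] balls of
    radius less than [k^-L = psi q / |q|]: digits of [A] above degree [-L] in all rows but
    one, together with the polynomial part of [qA], determine the remaining row.  The
    total cost in dimension [n(m-1) + e] is the tail of the series defining [eta].

    Lower bound.  If the series diverges at exponents above [e], there are infinitely
    many scales [(d, r)] at which at least [k^((d+r)e - dn)] vectors [q] have [|q| = k^d]
    and [psi q >= k^-r].  The normalised sum of the indicators of the strips
    [||qA|| < k^-r] over these [q] is, in terms of the successive digits of [A], a
    martingale equal to [1] until depth [d] and constant from depth [d + r] on; hence the
    product over a sparse sequence of scales is again a martingale, i.e. a mass
    distribution on the tree of digits, carried by [W].  By duality of finite vector
    spaces the correlation of the strips of [q] and [q'] at depth [d + t] is the number of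
    pairs of polynomial vectors [c, c'] of degree less than [t] with
    [c_j q_i + c'_j q'_i = 0]; summed over [q'], this is controlled by the number of
    divisors of [c_j q_i], which is [O(k^(eps (d+t)))].  The second moments of the density
    thus grow slowly enough for the energy to be finite, and a mass distribution of
    finite energy admits a path of positive mass that avoids any cheap covering. *)
Require Import Defs.
From HB Require Import structures.
From mathcomp Require Import all_boot all_order all_algebra all_field.
From mathcomp Require Import all_classical all_reals all_analysis.
From mathcomp Require Import ring lra zify.
Set Implicit Arguments. Unset Strict Implicit. Unset Printing Implicit Defensive.
Import Order.TTheory GRing.Theory Num.Theory.
Local Open Scope ring_scope.

(** * Divisors of polynomials *)

Lemma bernoulli_le (R : realType) (x : R) (e : nat) : 1 <= x ->
  1 + e%:R * (x - 1) <= x ^+ e.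
Proof.
move=> x1; elim: e => [|e IHe]; first by rewrite expr0 mul0r addr0.
rewrite exprS; apply: (@le_trans _ _ (x * (1 + e%:R * (x - 1)))).
  rewrite -subr_ge0 -natr1.
  rewrite (_ : _ - _ = e%:R * (x - 1) ^+ 2); last by ring.
  by rewrite mulr_ge0 ?ler0n ?sqr_ge0.
by rewrite ler_wpM2l // (le_trans ler01).
Qed.

Section Divisors.
Variable F : finFieldType.

(** Induction on [e]. The divisors of [p ^+ e.+1 * g] that [p] divides become, after division by
    [p], divisors of [p ^+ e * g]; the others are coprime to [p], hence divide [g]. *)
Lemma ndiv_irreducible_exp_mul (p g : {poly F}) (N e : nat) :
  irreducible_poly p ->
  (forall s, uniq s -> all (fun h => h %| g) s -> (size s <= N)%N) ->
  forall s, uniq s -> all (fun h => h %| p ^+ e * g) s ->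
    (size s <= e.+1 * N)%N.
Proof.
move=> irrp ndg; elim: e => [|e IHe] s us sd.
  by rewrite mul1n; apply: ndg => //; move: sd; rewrite expr0 mul1r.
have p0 : p != 0 by rewrite -size_poly_gt0; case: irrp => /ltnW.
rewrite -(count_predC (fun h => p %| h) s) -!size_filter mulSnr.
apply: leq_add.
  rewrite -(size_map (fun h => h %/ p)); apply: IHe.
    rewrite map_inj_in_uniq ?filter_uniq // => a b.
    rewrite !mem_filter => /andP[pa _] /andP[pb _] ab.
    by rewrite -(divpK pa) ab divpK.
  apply/allP => h /mapP[h']; rewrite mem_filter => /andP[ph' h's ->].
  have := allP sd _ h's; rewrite -{1}(divpK ph') mulrC exprS -mulrA.
  by rewrite dvdp_mul2l.
apply: ndg; first by rewrite filter_uniq.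
apply/allP => h; rewrite mem_filter /= => /andP[ph hs].
have := allP sd _ hs; rewrite Gauss_dvdpr // coprimep_sym coprimep_expl //.
by rewrite irreducible_poly_coprime.
Qed.

Lemma irreducible_dvdp_exists (f : {poly F}) : (1 < size f)%N ->
  exists2 p : {poly F}, irreducible_poly p & p %| f.
Proof.
have [n] := ubnP (size f); elim: n f => // n IHn f fn f1.
have [irrf|] := pselect (irreducible_poly f); first by exists f; rewrite ?dvdpp.
move=> /not_andP[//|/existsNP[q /not_implyP[q1 /not_implyP[qf]]]] /negP qnf.
have f0 : f != 0 by rewrite -size_poly_gt0 ltnW.
have q0 : q != 0 by apply: contraNneq f0 => q0; move: qf; rewrite q0 dvd0p.
have sq : (size q < size f)%N.
  by rewrite ltn_neqAle dvdp_leq // andbT dvdp_size_eqp.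
have [||p irrp pq] := IHn q.
- by apply: leq_trans sq _.
- by rewrite ltn_neqAle eq_sym q1 size_poly_gt0.
- by exists p => //; apply: dvdp_trans pq qf.
Qed.

Lemma irreducible_factor_out (p f : {poly F}) : f != 0 -> irreducible_poly p ->
  exists e, exists2 g : {poly F}, f = p ^+ e * g & ~~ (p %| g).
Proof.
have [n] := ubnP (size f); elim: n f => // n IHn f fn f0 irrp.
have [pf|pf] := boolP (p %| f); last by exists 0%N, f; rewrite ?mul1r.
have p1 : (1 < size p)%N by case: irrp.
have p0 : p != 0 by rewrite -size_poly_gt0 ltnW.
have sfp : (size (f %/ p)%R < size f)%N.
  by rewrite size_divp // ltn_subrL -subn1 subn_gt0 p1 size_poly_gt0.
have [||//|e [g fg pg]] := IHn (f %/ p).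
- by apply: leq_trans sfp _.
- by rewrite dvdp_div_eq0.
- by exists e.+1, g => //; rewrite exprSr mulrAC -fg divpK.
Qed.

Variable R : realType.

Lemma expr_mul_size (x : R) (p g : {poly F}) e : p != 0 -> g != 0 ->
  x ^+ (size (p ^+ e * g)%R).-1 = x ^+ ((size p).-1 * e) * x ^+ (size g).-1.
Proof.
move=> p0 g0; rewrite size_mul ?expf_neq0 // -exprD; congr (_ ^+ _).
rewrite -size_exp; move: (expf_neq0 e p0) g0; rewrite -!size_poly_gt0.
by case: (size _) => // a; case: (size _) => // b; rewrite addSn addnS.
Qed.

(** Splitting off one irreducible factor [p] at most doubles the number of divisors, while the right
    side gains [x ^+ (size p).-1], at least [x ^+ T] because [p] is large. In the end only constants
    remain, whence [#|F|]. *)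
Lemma ndiv_rough (x : R) (T : nat) : 1 < x -> 2 <= x ^+ T ->
  forall f : {poly F}, f != 0 ->
  (forall p : {poly F}, irreducible_poly p -> p %| f -> (T < size p)%N) ->
  forall s, uniq s -> all (fun h => h %| f) s ->
    (size s)%:R <= #|F|%:R * x ^+ (size f).-1.
Proof.
move=> x1 xT f; have [n] := ubnP (size f); elim: n f => // n IHn f fn f0 rough s us sd.
have [f1|f1] := leqP (size f) 1.
  have -> : (size f).-1 = 0%N by move: f1; lia.
  rewrite expr0 mulr1 ler_nat.
  apply: (@leq_trans (size [seq a%:P | a <- enum F])); last by rewrite size_map cardE.
  apply: uniq_leq_size => // h /(allP sd) hf.
  have /size1_polyC -> : (size h <= 1)%N by apply: leq_trans f1; rewrite dvdp_leq.
  by apply: map_f; rewrite mem_enum.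
have [p irrp pf] := irreducible_dvdp_exists f1.
have p1 : (1 < size p)%N by case: irrp.
have p0 : p != 0 by rewrite -size_poly_gt0 ltnW.
set g := f %/ p; have fg : f = p ^+ 1 * g by rewrite expr1 mulrC divpK.
have g0 : g != 0 by rewrite dvdp_div_eq0.
have sgf : (size g < size f)%N.
  by rewrite size_divp // ltn_subrL -subn1 subn_gt0 p1 size_poly_gt0.
have xg : 0 <= #|F|%:R * x ^+ (size g).-1.
  by rewrite mulr_ge0 ?exprn_ge0 ?ler0n //; lra.
have Ng s' : uniq s' -> all (fun h => h %| g) s' ->
    (size s' <= Num.truncn (#|F|%:R * x ^+ (size g).-1))%N.
  move=> us' sd'; rewrite -ltnS -(ltr_nat R).
  apply: le_lt_trans (truncnS_gt _); apply: IHn => //.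
    exact: leq_trans sgf _.
  move=> q irrq qg; apply: rough => //; rewrite fg expr1; exact: dvdp_mull.
have := ndiv_irreducible_exp_mul (e := 1) irrp Ng us.
rewrite -fg => /(_ sd); rewrite -(ler_nat R) => /le_trans; apply.
rewrite natrM [in leRHS]fg expr_mul_size // muln1 mulrCA.
apply: ler_pM; rewrite ?ler0n //; last by rewrite truncn_le.
apply: le_trans xT _; rewrite ler_eXn2l //.
by have := rough _ irrp pf; lia.
Qed.

(* The list [ps] contains the small irreducible factors still to be removed; each
   one, of multiplicity [e], multiplies the number of divisors by [e.+1 <= C * x ^+ e]. *)
Lemma ndiv_smooth (x C : R) (T : nat) : 1 < x -> 2 <= x ^+ T -> 1 <= C ->
  (forall e : nat, e.+1%:R <= C * x ^+ e) ->
  forall (ps : seq {poly F}) (f : {poly F}), f != 0 ->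
  (forall p : {poly F}, irreducible_poly p -> p %| f -> p \notin ps ->
     (T < size p)%N) ->
  forall s, uniq s -> all (fun h => h %| f) s ->
    (size s)%:R <= C ^+ size ps * (#|F|%:R * x ^+ (size f).-1).
Proof.
move=> x1 xT C1 Ce; have C0 : 0 <= C by lra.
have x0 : 0 <= x by lra.
elim=> [|p ps IHps] f f0 rough s us sd.
  rewrite mul1r; apply: (ndiv_rough x1 xT f0) => // q irrq qf; exact: rough.
have [irrp|nirrp] := pselect (irreducible_poly p); last first.
  apply: (@le_trans _ _ (C ^+ size ps * (#|F|%:R * x ^+ (size f).-1))).
    apply: IHps => // q irrq qf qps; apply: rough => //.
    by rewrite inE negb_or qps andbT; apply: contra_notN nirrp => /eqP <-.
  by rewrite ler_wpM2r ?mulr_ge0 ?exprn_ge0 ?ler0n // exprS ler_peMl ?exprn_ge0.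
have p1 : (1 < size p)%N by case: irrp.
have p0 : p != 0 by rewrite -size_poly_gt0 ltnW.
have [e [g fg pg]] := irreducible_factor_out f0 irrp.
have g0 : g != 0 by apply: contraNneq f0 => g0; rewrite fg g0 mulr0.
have Ng s' : uniq s' -> all (fun h => h %| g) s' ->
    (size s' <= Num.truncn (C ^+ size ps * (#|F|%:R * x ^+ (size g).-1)))%N.
  move=> us' sd'; rewrite -ltnS -(ltr_nat R).
  apply: le_lt_trans (truncnS_gt _); apply: IHps => // q irrq qg qps.
  apply: rough => //; first by rewrite fg dvdp_mull.
  by rewrite inE negb_or qps andbT; apply: contraNneq pg => <-.
have := ndiv_irreducible_exp_mul (e := e) irrp Ng us.
rewrite -fg => /(_ sd); rewrite -(ler_nat R) => /le_trans; apply.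
rewrite natrM /= exprS [in leRHS]fg expr_mul_size //.
rewrite [X in _ <= _ * (_ * X)]mulrC.
rewrite (_ : C * _ * _ = (C * x ^+ ((size p).-1 * e)) *
  (C ^+ size ps * (#|F|%:R * x ^+ (size g).-1))); last by ring.
apply: ler_pM; rewrite ?ler0n //; last first.
  by rewrite truncn_le ?mulr_ge0 ?exprn_ge0 ?ler0n.
apply: le_trans (Ce e) _; rewrite ler_wpM2l // ler_eXn2l //.
by move: p1; nia.
Qed.

(** This is the bound O(|f|^eps) for the number of divisors, with [x = k^eps]: irreducible factors
    of size above [T] fall under [ndiv_rough], and only finitely many polynomials have size at most
    [T]. *)
Lemma divisor_bound (x : R) : 1 < x ->
  exists2 C : R, 0 <= C & forall f : {poly F}, f != 0 ->
  forall s, uniq s -> all (fun h => h %| f) s ->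
    (size s)%:R <= C * x ^+ (size f).-1.
Proof.
move=> x1; have y0 : 0 < x - 1 by rewrite subr_gt0.
have [T xT] : exists T, 2 <= x ^+ T.
  have yi : 0 <= (x - 1)^-1 by rewrite invr_ge0 ltW.
  exists (Num.Def.archi_bound (x - 1)^-1); apply: le_trans (bernoulli_le _ (ltW x1)).
  have := archi_boundP yi; rewrite -(ltr_pM2r y0) mulVf ?gt_eqF //; lra.
(* By Bernoulli [C * x ^+ e] is at least [C * (1 + e * (x - 1))], and this [C] makes the latter at
   least [1 + e]. *)
pose C := 1 + (x - 1)^-1.
have C1 : 1 <= C by rewrite lerDl invr_ge0 ltW.
have Ce (e : nat) : e.+1%:R <= C * x ^+ e.
  apply: le_trans (_ : C * (1 + e%:R * (x - 1)) <= _); last first.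
    by rewrite ler_wpM2l ?bernoulli_le ?(ltW x1) // (le_trans ler01 C1).
  rewrite -natr1 /C mulrDl mul1r.
  have -> : (x - 1)^-1 * (1 + e%:R * (x - 1)) = (x - 1)^-1 + e%:R.
    by field; rewrite subr_eq0 gt_eqF.
  have : 0 <= e%:R * (x - 1) by rewrite mulr_ge0 ?ler0n // ltW.
  have : 0 <= (x - 1)^-1 by rewrite invr_ge0 ltW.
  by lra.
pose ps := [seq rVpoly v | v <- enum 'rV[F]_T].
exists (C ^+ size ps * #|F|%:R).
  by rewrite mulr_ge0 ?ler0n ?exprn_ge0 // (le_trans ler01 C1).
move=> f f0 s us sd; rewrite -mulrA.
apply: (ndiv_smooth x1 xT C1 Ce f0 _ us sd) => p irrp pf.
rewrite ltnNge; apply: contraNN => pT; apply/mapP; exists (poly_rV p).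
  by rewrite mem_enum.
by rewrite poly_rV_K.
Qed.
End Divisors.

(** * Mass distributions on a tree of words *)

Section Words.
Variable V : finType.

Fixpoint words (l : nat) : seq (seq V) :=
  if l is l'.+1 then [seq rcons v a | v <- words l', a <- enum V] else [:: [::]].

Lemma mem_words l v : (v \in words l) = (size v == l).
Proof.
elim: l v => [|l IHl] v /=; first by rewrite inE size_eq0.
apply/allpairsP/eqP => [[[w a] /= [wl _ ->]]|].
  by rewrite size_rcons; move: wl; rewrite IHl => /eqP ->.
case/lastP: v => // w a; rewrite size_rcons => -[wl].
by exists (w, a); rewrite /= IHl wl eqxx mem_enum.
Qed.

Lemma uniq_words l : uniq (words l).
Proof.
elim: l => //= l IHl; apply: allpairs_uniq => //; first exact: enum_uniq.
by move=> [v a] [w b] _ _ /= /rcons_inj[-> ->].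
Qed.

Lemma big_wordsS (R : realType) l (G : seq V -> R) :
  \sum_(v <- words l.+1) G v = \sum_(v <- words l) \sum_a G (rcons v a).
Proof.
by rewrite big_allpairs_dep /=; apply: eq_bigr => v _; rewrite big_enum.
Qed.

End Words.

Lemma ler_sum_uniq_sub (R : realType) (I : eqType) (s t : seq I) (G : I -> R) :
  uniq s -> uniq t -> {subset s <= t} -> (forall i, 0 <= G i) ->
  \sum_(i <- s) G i <= \sum_(i <- t) G i.
Proof.
move=> us ut st G0.
rewrite (perm_big [seq i <- t | i \in s]); last first.
  apply: uniq_perm; rewrite ?filter_uniq // => i; rewrite mem_filter.
  by have [/st ->|] := boolP (i \in s).
by rewrite big_filter [leRHS](bigID (fun i => i \in s)) /= lerDl sumr_ge0.
Qed.

Section Avoid.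
Variables (R : realType) (V : finType) (mu : seq V -> R).
Hypothesis mu_ge0 : forall v, 0 <= mu v.
Hypothesis mu_split : forall v, mu v = \sum_a mu (rcons v a).
Variable H : pred (seq V).

(* Nested vertices of [H] are counted separately, which makes the count additive
   over children. *)
Fixpoint forbidden (L : nat) (v : seq V) : R :=
  (if H v then mu v else 0) +
  (if L is L'.+1 then \sum_a forbidden L' (rcons v a) else 0).

Lemma forbidden_ge0 L v : 0 <= forbidden L v.
Proof.
elim: L v => [|L IHL] v /=; first by rewrite addr0; case: ifP.
by apply: addr_ge0; [case: ifP|apply: sumr_ge0].
Qed.

Lemma forbidden_mono L L' v : (L <= L')%N -> forbidden L v <= forbidden L' v.
Proof.
elim: L L' v => [|L IHL] [|L'] v //= LL'; rewrite lerD2l.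
  by apply: sumr_ge0 => a _; exact: forbidden_ge0.
by apply: ler_sum => a _; exact: IHL.
Qed.

(** The margin is uniform in [L], so it controls forbidden vertices at all depths at once. *)
Definition escaping v := exists2 eps, 0 < eps & forall L, forbidden L v + eps <= mu v.

(** If no child escaped, each child [a] would fail the margin [eps / N] at some depth [L a]. At the
    largest of these depths the losses add up to [#|V| * eps / N], which is less than [eps], against
    the margin of [v]. *)
Lemma escaping_child v : escaping v -> exists a, escaping (rcons v a).
Proof.
move=> [eps eps0 veps]; apply: contrapT => none.
pose N : R := #|V|.+1%:R; have N0 : 0 < N by rewrite ltr0n.
have /choice[L LP] : forall a, exists L, mu (rcons v a) < forbidden L (rcons v a) + eps / N.
  move=> a; apply: contrapT => nL; apply: none; exists a.
  exists (eps / N); first exact: divr_gt0.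
  by move=> L; rewrite leNgt; apply/negP => h; apply: nL; exists L.
have := veps (\max_a L a).+1; rewrite /= [leRHS]mu_split leNgt; apply/negP.
rewrite negbK; apply: (@le_lt_trans _ _ (\sum_a (forbidden (L a) (rcons v a) + eps / N))).
  by apply: ler_sum => a _; exact: ltW.
rewrite big_split /= sumr_const; apply: ler_ltD.
  apply: le_trans (_ : \sum_a forbidden (\max_a L a) (rcons v a) <= _).
    by apply: ler_sum => a _; apply: forbidden_mono; exact: leq_bigmax.
  by rewrite lerDr; case: ifP.
rewrite -mulr_natl mulrCA -ltr_pdivlMl // mulVf ?gt_eqF //.
by rewrite ltr_pdivrMr // mul1r ltr_nat.
Qed.

Lemma avoiding_path : escaping [::] ->
  exists x : nat -> V, forall l, 0 < mu (mkseq x l) /\ ~~ H (mkseq x l).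
Proof.
move=> esc0; have [a0 _] := escaping_child esc0.
have /choice[f fP] : forall v, exists a, escaping v -> escaping (rcons v a).
  move=> v; have [/escaping_child[a va]|nv] := pselect (escaping v); last by exists a0.
  by exists a.
pose w := fix w l := if l is l'.+1 then rcons (w l') (f (w l')) else [::].
exists (fun l => f (w l)) => l.
have -> : mkseq (fun l => f (w l)) l = w l.
  by elim: l => //= l IHl; rewrite mkseqS IHl.
have [eps eps0 /(_ 0%N)] : escaping (w l) by elim: l => //= l IHl; exact: fP.
rewrite /= addr0; case: ifP => /= _ h.
  by move: h; rewrite gerDl leNgt eps0.
by rewrite (lt_le_trans _ h) // add0r.
Qed.

Lemma forbidden_words L j : \sum_(v <- words V j) forbidden L v =
  \sum_(i < L.+1) \sum_(v <- words V (j + i)%N | H v) mu v.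
Proof.
elim: L j => [|L IHL] j /=.
  rewrite big_ord1 addn0 [RHS]big_mkcond.
  by apply: eq_bigr => v _; rewrite addr0.
rewrite big_split /= -big_wordsS IHL [RHS]big_ord_recl addn0 -big_mkcond.
by congr (_ + _); apply: eq_bigr => i _; rewrite lift0 addSnnS.
Qed.

End Avoid.

Section Frostman.
Variables (R : realType) (V : finType) (mu : seq V -> R) (om : nat -> R).
Hypothesis mu_ge0 : forall v, 0 <= mu v.
Hypothesis mu_split : forall v, mu v = \sum_a mu (rcons v a).
Hypothesis mu_nil : mu [::] = 1.
Hypothesis om_gt0 : forall l, 0 < om l.

(** By [amgm] the forbidden mass is at most the energy over [4 * C] plus [4 * C] times the total
    weight of the forbidden words. Both parts are at most 1/4, so the root escapes with margin
    1/2. *)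
Lemma energy_avoid (C : R) (b : nat -> seq V) : 0 < C ->
  (forall L, \sum_(l < L) \sum_(v <- words V l) mu v ^+ 2 / om l <= C) ->
  (forall M, \sum_(i < M) om (size (b i)) <= (16 * C)^-1) ->
  exists x : nat -> V, forall l, 0 < mu (mkseq x l) /\ forall i, mkseq x l <> b i.
Proof.
move=> C0 energy small; pose H : pred (seq V) := fun v => `[< exists i, v = b i >].
suff esc : escaping mu H [::].
  have [x xP] := avoiding_path mu_ge0 mu_split esc; exists x => l.
  have [mu0 /asboolPn nH] := xP l; split=> // i xb; apply: nH; by exists i.
exists (1 / 2); first by rewrite divr_gt0.
move=> L; rewrite mu_nil -lerBrDr.
have -> : forbidden mu H L [::] = \sum_(v <- words V 0) forbidden mu H L v.
  by rewrite big_seq1.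
rewrite forbidden_words.
have amgm v l : mu v <= (mu v ^+ 2 / om l) / (4 * C) + 4 * C * om l.
  have a0 : 0 < 4 * C * om l by rewrite !mulr_gt0.
  have -> : (mu v ^+ 2 / om l) / (4 * C) = mu v * (mu v / (4 * C * om l)).
    by field; rewrite !gt_eqF ?om_gt0.
  have [h|h] := leP (mu v) (4 * C * om l).
    by rewrite ler_wpDl // mulr_ge0 // divr_ge0 // ltW.
  rewrite ler_wpDr ?(ltW a0) // ler_peMr //.
  by rewrite ler_pdivlMr // mul1r ltW.
apply: (@le_trans _ _ (\sum_(i < L.+1) \sum_(v <- words V i) (mu v ^+ 2 / om i) / (4 * C) +
  \sum_(i < L.+1) \sum_(v <- words V i | H v) 4 * C * om i)).
  rewrite -big_split /=; apply: ler_sum => i _; rewrite add0n.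
  apply: le_trans (_ : \sum_(v <- words V i | H v) ((mu v ^+ 2 / om i) / (4 * C) + 4 * C * om i) <= _).
    by apply: ler_sum => v _; exact: amgm.
  rewrite big_split /= lerD2r [leRHS](bigID H) /= lerDl sumr_ge0 // => v _.
  by rewrite !divr_ge0 ?sqr_ge0 ?mulr_ge0 // ltW.
have -> : 1 - 1 / 2 = 4^-1 + 4^-1 :> R by field.
apply: lerD.
  under eq_bigr => i _ do rewrite -mulr_suml.
  rewrite -mulr_suml ler_pdivrMr ?mulr_gt0 //.
  by rewrite mulrA mulVf // mul1r energy.
(* [s] lists the forbidden words of length at most [L] without repetition. Distinct words choose
   distinct indices [i] with [v = b i], so their weight is at most a partial sum over all [b i]. *)
pose s := flatten [seq [seq v <- words V i | H v] | i <- iota 0 L.+1].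
have sumE : \sum_(i < L.+1) \sum_(v <- words V i | H v) 4 * C * om i =
    4 * C * \sum_(v <- s) om (size v).
  rewrite /s big_flatten big_map -[iota 0 L.+1]/(index_iota 0 L.+1) big_mkord mulr_sumr.
  apply: eq_bigr => i _; rewrite big_filter mulr_sumr big_seq_cond [RHS]big_seq_cond.
  by apply: eq_bigr => v; rewrite mem_words => /andP[/eqP -> _].
rewrite sumE mulrC -ler_pdivlMr ?mulr_gt0 //.
have us : uniq s.
  rewrite /s; elim: (iota _ _) (iota_uniq 0 L.+1) => //= i t IH /andP[it ut].
  rewrite cat_uniq filter_uniq ?uniq_words //= IH // andbT.
  apply/hasPn => v /flatten_mapP[j jt]; rewrite mem_filter mem_words => /andP[_ /eqP vj].
  rewrite /= mem_filter mem_words vj; apply/negP => /andP[_ /eqP ji].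
  by rewrite -ji jt in it.
have sH v : v \in s -> exists i, v = b i.
  by move=> /flatten_mapP[j _]; rewrite mem_filter => /andP[/asboolP].
have /choice[f fP] : forall v, exists i, v \in s -> v = b i.
  move=> v; have [/sH[i ->]|] := boolP (v \in s); first by exists i.
  by exists 0%N.
have -> : \sum_(v <- s) om (size v) = \sum_(i <- map f s) om (size (b i)).
  by rewrite big_map !big_seq; apply: eq_bigr => v vs; rewrite -(fP v vs).
pose M := (\max_(i <- map f s) i).+1.
apply: (@le_trans _ _ (\sum_(i <- iota 0 M) om (size (b i)))).
  apply: ler_sum_uniq_sub; rewrite ?iota_uniq //.
  - by rewrite map_inj_in_uniq // => v w vs ws fvw; rewrite (fP v vs) (fP w ws) fvw.
  - by move=> i is'; rewrite mem_iota /= add0n ltnS; exact: leq_bigmax_seq.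
  - by move=> i; exact: ltW.
rewrite -[iota 0 M]/(index_iota 0 M) big_mkord; apply: le_trans (small M) _.
by rewrite le_eqVlt; apply/orP; left; apply/eqP; field; rewrite gt_eqF.
Qed.

End Frostman.

(** * Counting solutions of linear conditions on words *)

(** [sigma y] maps each fibre injectively into the fibre translated by [y]; going both ways, all
    fibres have the same size. *)
Lemma card_fiber (G : finType) (G' : finZmodType) (phi : G -> G') (sigma : G' -> G -> G) :
  (forall y, injective (sigma y)) -> (forall y a, phi (sigma y a) = phi a + y) ->
  forall y0, (#|[set a | phi a == y0]| * #|G'| = #|G|)%N.
Proof.
move=> injs phis y0.
have le y1 y2 : (#|[set a | phi a == y1]| <= #|[set a | phi a == y2]|)%N.
  rewrite -(card_imset _ (injs (y2 - y1))); apply: subset_leq_card.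
  apply/fintype.subsetP => _ /imsetP[a + ->]; rewrite !inE => /eqP ay.
  by rewrite phis ay addrC subrK.
have cardE y : #|[set a | phi a == y]| = #|[set a | phi a == y0]|.
  by apply/eqP; rewrite eqn_leq !le.
rewrite -[RHS]sum1_card (partition_big phi xpredT) //=.
under eq_bigr => y _.
  rewrite (eq_bigl (fun a => a \in [set a | phi a == y])); last by move=> a; rewrite inE.
  rewrite sum1_card cardE; over.
by rewrite sum_nat_const mulnC.
Qed.

Lemma card_set_sum (T : finType) (P : pred T) : #|[set x | P x]| = (\sum_x P x)%N.
Proof.
by rewrite -sum1dep_card big_mkcond; apply: eq_bigr => x _; case: (P x).
Qed.

Section Duality.
Variables (F : finFieldType) (U W : finType) (beta : U -> W -> F).
Hypothesis fiberU : forall w, (exists u, beta u w != 0) ->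
  (#|[set u | beta u w == 0%R]| * #|F| = #|U|)%N.
Hypothesis fiberW : forall u, (exists w, beta u w != 0) ->
  (#|[set w | beta u w == 0%R]| * #|F| = #|W|)%N.

(** Double count of the pairs with [beta u w = 0]: an element outside the kernel contributes the
    proportion [1 / #|F|] of the other side, an element of the kernel all of it. Comparing the two
    counts leaves the two kernels. *)
Lemma pairing_duality :
  (#|[set u | [forall w, beta u w == 0%R]]| * #|W| =
   #|[set w | [forall u, beta u w == 0%R]]| * #|U|)%N.
Proof.
set K := [set u | _]; set K' := [set w | _].
have F1 : (1 < #|F|)%N := finNzRing_gt1 F.
have countU u : (#|[set w | beta u w == 0%R]| * #|F| = #|W| + (u \in K) * (#|F|.-1 * #|W|))%N.
  have [uK|uK] := boolP (u \in K).
    have -> : #|[set w | beta u w == 0%R]| = #|W|.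
      by apply: eq_card => w; rewrite !inE; move: uK; rewrite inE => /forallP/(_ w).
    by rewrite mul1n -mulSn prednK ?(ltnW F1) // mulnC.
  rewrite mul0n addn0; apply: fiberW; move: uK; rewrite inE negb_forall => /existsP[w wP].
  by exists w.
have countW w : (#|[set u | beta u w == 0%R]| * #|F| = #|U| + (w \in K') * (#|F|.-1 * #|U|))%N.
  have [wK|wK] := boolP (w \in K').
    have -> : #|[set u | beta u w == 0%R]| = #|U|.
      by apply: eq_card => u; rewrite !inE; move: wK; rewrite inE => /forallP/(_ u).
    by rewrite mul1n -mulSn prednK ?(ltnW F1) // mulnC.
  rewrite mul0n addn0; apply: fiberU; move: wK; rewrite inE negb_forall => /existsP[u uP].
  by exists u.
have total : (\sum_u #|[set w | beta u w == 0%R]| = \sum_w #|[set u | beta u w == 0%R]|)%N.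
  under eq_bigr => u _ do rewrite card_set_sum.
  by rewrite exchange_big; apply: eq_bigr => w _; rewrite card_set_sum.
have := congr1 (fun x => x * #|F|)%N total; rewrite !big_distrl /=.
under eq_bigr => u _ do rewrite countU.
under [RHS]eq_bigr => w _ do rewrite countW.
rewrite !big_split /= !sum_nat_const -!big_distrl /= [X in (X + _)%N]mulnC => /addnI.
have cardK (T : finType) (A : {set T}) : (\sum_x (x \in A) = #|A|)%N.
  by rewrite -card_set_sum; congr #|pred_of_set _|; apply/setP => x; rewrite inE.
by rewrite !cardK mulnCA [RHS]mulnCA => /eqP; rewrite eqn_pmul2l ?ltn_predRL // => /eqP.
Qed.

End Duality.

Section PairCount.
Variables (F : finFieldType) (m n : nat).
Local Notation V := 'M[F]_(m, n).
Implicit Types (q : 'rV[{poly F}]_m) (v : seq V).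

(* If [v] lists the digits of [A] in degrees -1, -2, ..., this is the coefficient of
   degree [-(s + 1)] of the [j]-th entry of [qA]. *)
Definition wcoef q v (j : 'I_n) (s : nat) : F :=
  \sum_(i < m) \sum_(e < size (q ord0 i)) (q ord0 i)`_e * nth 0 v (s + e)%N i j.

(** For [v] long enough this is the condition [||qA|| < k^-t]; digits beyond the end of [v] are read
    as 0. *)
Definition wstrip q (t : nat) v : bool :=
  [forall j, [forall s : 'I_t, wcoef q v j s == 0]].

Section Words.
Variable l : nat.
Local Notation U := {ffun 'I_l -> V}.

Definition word (u : U) : seq V := mkseq (fun p => oapp u 0 (insub p)) l.

Lemma size_word u : size (word u) = l.
Proof. exact: size_mkseq. Qed.

Lemma nth_word u p : nth 0 (word u) p = oapp u 0 (insub p).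
Proof.
have [pl|lp] := ltnP p l; first by rewrite nth_mkseq.
by rewrite nth_default ?size_word // insubF // ltnNge lp.
Qed.

Lemma big_words_ffun (R : realType) (G : seq V -> R) : \sum_(v <- words V l) G v = \sum_(u : U) G (word u).
Proof.
rewrite -big_enum -(big_map word xpredT G); apply: perm_big.
apply: uniq_perm; first exact: uniq_words.
  rewrite map_inj_uniq ?enum_uniq // => u u' uu'; apply/ffunP => i.
  by have := congr1 (fun s => nth 0 s i) uu'; rewrite !nth_word valK.
move=> v; rewrite mem_words; apply/eqP/mapP => [vl|[u _ ->]]; last exact: size_word.
exists [ffun i : 'I_l => nth 0 v i]; first by rewrite mem_enum.
apply: (@eq_from_nth _ 0) => [|p pv]; first by rewrite size_word.
have pl : (p < l)%N by rewrite -vl.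
by rewrite nth_word insubT /= ffunE.
Qed.

Lemma wcoef_linear q (c : F) (u u' : U) j s :
  wcoef q (word (c *: u + u')) j s = c * wcoef q (word u) j s + wcoef q (word u') j s.
Proof.
rewrite /wcoef mulr_sumr -big_split; apply: eq_bigr => i _ /=.
rewrite mulr_sumr -big_split; apply: eq_bigr => e _ /=; rewrite !nth_word.
case: insubP => [p _ _|_]; last by rewrite !mxE !mulr0 addr0.
by rewrite /= !ffunE !mxE mulrDr mulrCA.
Qed.

Definition unit_word (p : 'I_l) (i : 'I_m) (j : 'I_n) : U :=
  [ffun p' => if p' == p then delta_mx i j else 0].

(** The form ['X^s * q_i] lets linear combinations over [s] become products of polynomials in
    [relationsP]. *)
Lemma wcoef_unit_word q p i j s :
  wcoef q (word (unit_word p i j)) j s = ('X^s * q ord0 i)`_p.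
Proof.
rewrite /wcoef (bigD1 i) //= [X in _ + X]big1 ?addr0; last first.
  move=> i' i'i; rewrite big1 // => e _; rewrite nth_word.
  case: insubP => [p' _ _|_]; last by rewrite mxE mulr0.
  by rewrite /= ffunE; case: ifP => _; rewrite !mxE ?(negbTE i'i) /= mulr0.
have nthE e : nth 0 (word (unit_word p i j)) (s + e) i j = (s + e == p)%N%:R :> F.
  rewrite nth_word; case: insubP => [p' _ <-|pl].
    by rewrite /= ffunE -val_eqE; case: ifP => _; rewrite !mxE ?eqxx.
  by rewrite mxE; case: eqP => // sep; move: pl; rewrite sep ltn_ord.
rewrite coefXnM; case: ltnP => ps.
  rewrite big1 // => e _; rewrite nthE; case: eqP => [sep|]; last by rewrite mulr0.
  by move: ps; rewrite -sep ltnNge leq_addr.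
have [pq|pq] := ltnP (p - s) (size (q ord0 i)).
  rewrite (bigD1 (Ordinal pq)) //= nthE subnKC // eqxx mulr1 big1 ?addr0 // => e ep.
  rewrite nthE; case: eqP => [sep|]; last by rewrite mulr0.
  by case/eqP: ep; apply: val_inj => /=; rewrite -sep addKn.
rewrite nth_default // big1 // => e _; rewrite nthE; case: eqP => [sep|]; last by rewrite mulr0.
by move: pq; rewrite -sep addKn leqNgt ltn_ord.
Qed.

Variables (t : nat) (q q' : 'rV[{poly F}]_m).
Local Notation W := ('M[F]_(n, t) * 'M[F]_(n, t))%type.

(** A general combination, with coefficients [w], of the linear conditions that define the strips of
    [q] and [q']; its kernel in [u] is the intersection of the strips. *)
Definition wpair (u : U) (w : W) : F :=
  \sum_j \sum_(s < t) (w.1 j s * wcoef q (word u) j s + w.2 j s * wcoef q' (word u) j s).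

Lemma wpair_linearl c u u' w : wpair (c *: u + u') w = c * wpair u w + wpair u' w.
Proof.
rewrite /wpair mulr_sumr -big_split; apply: eq_bigr => j _ /=.
rewrite mulr_sumr -big_split; apply: eq_bigr => s _ /=.
by rewrite !wcoef_linear; ring.
Qed.

Lemma wpair_linearr c u w w' : wpair u (c *: w + w') = c * wpair u w + wpair u w'.
Proof.
rewrite /wpair mulr_sumr -big_split; apply: eq_bigr => j _ /=.
rewrite mulr_sumr -big_split; apply: eq_bigr => s _ /=.
by rewrite !mxE; ring.
Qed.

(* The kernel of [wpair] on the other side: pairs of polynomial vectors [(c, c')] of
   size at most [t] with [c_j q_i + c'_j q'_i = 0] for all [i, j] (see [relationsP]). *)
Definition relations : {set W} := [set w | [forall u, wpair u w == 0]].

Lemma card_two_strips :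
  (#|[set u : U | wstrip q t (word u) && wstrip q' t (word u)]| * #|F| ^ (2 * t * n) =
   #|relations| * #|F| ^ (l * m * n))%N.
Proof.
have -> : (#|F| ^ (2 * t * n) = #|{: W}|)%N.
  by rewrite card_prod !card_mx -expnD; congr (_ ^ _)%N; lia.
have -> : (#|F| ^ (l * m * n) = #|{: U}|)%N.
  by rewrite card_ffun card_mx card_ord -expnM; congr (_ ^ _)%N; lia.
rewrite -[RHS](pairing_duality (beta := wpair)).
- congr (_ * _)%N; apply: eq_card => u; rewrite !inE; apply/andP/forallP.
    move=> [/forallP qu /forallP q'u] w; rewrite /wpair big1 // => j _; rewrite big1 // => s _.
    by rewrite (eqP (forallP (qu j) s)) (eqP (forallP (q'u j) s)) !mulr0 addr0.
  move=> uw; split; apply/forallP => j; apply/forallP => s.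
    (* Elementary matrices isolate single conditions, here of [q] and below of [q']. *)
    have := uw (delta_mx j s, 0); rewrite /wpair (bigD1 j) //= (bigD1 s) //= !mxE !eqxx mul1r mul0r addr0.
    rewrite big1 => [|s' s's]; last by rewrite !mxE eqxx (negbTE s's) !mul0r addr0.
    rewrite addr0 big1 ?addr0 // => j' j'j; rewrite big1 // => s' _.
    by rewrite !mxE (negbTE j'j) !mul0r addr0.
  have := uw (0, delta_mx j s); rewrite /wpair (bigD1 j) //= (bigD1 s) //= !mxE !eqxx mul1r mul0r add0r.
  rewrite big1 => [|s' s's]; last by rewrite !mxE eqxx (negbTE s's) !mul0r addr0.
  rewrite addr0 big1 ?addr0 // => j' j'j; rewrite big1 // => s' _.
  by rewrite !mxE (negbTE j'j) !mul0r addr0.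
- move=> w [u0 u0w].
  apply: (card_fiber (phi := fun u => wpair u w) (sigma := fun y u => (y / wpair u0 w) *: u0 + u)).
    by move=> y; exact: addrI.
  by move=> y a; rewrite wpair_linearl divfK // addrC.
- move=> u [w0 uw0].
  apply: (card_fiber (phi := fun w => wpair u w) (sigma := fun y w => (y / wpair u w0) *: w0 + w)).
    by move=> y; exact: addrI.
  by move=> y a; rewrite wpair_linearr divfK // addrC.
Qed.

(** Pairing [w] with the unit word at [(p, i, j)] gives the coefficient of degree [p] of the
    combination. The size conditions bound the products by size [l], so these tests reach every
    coefficient. *)
Lemma relationsP w : w \in relations ->
  (forall i, size (q ord0 i) + t <= l.+1)%N -> (forall i, size (q' ord0 i) + t <= l.+1)%N ->
  forall i j, rVpoly (row j w.1) * q ord0 i + rVpoly (row j w.2) * q' ord0 i = 0.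
Proof.
rewrite inE => /forallP uw ql q'l i j.
have szM (c : 'rV[F]_t) (p : {poly F}) : (size p + t <= l.+1)%N -> (size (rVpoly c * p)%R <= l)%N.
  move=> pl; apply: leq_trans (size_polyMleq _ _) _.
  have := size_poly t (fun i => if insub i is Some i' then c 0 i' else 0); rewrite -/(rVpoly c); lia.
apply/polyP => p; rewrite coef0; have [pl|lp] := ltnP p l; last first.
  by rewrite coefD !nth_default ?addr0 // (leq_trans _ lp) // szM.
have := uw (unit_word (Ordinal pl) i j); rewrite /wpair (bigD1 j) //= [X in _ + X]big1 ?addr0.
  move=> /eqP upair0; rewrite -[RHS]upair0 big_split /= coefD.
  have coefE (c : 'rV[F]_t) (g : {poly F}) : (rVpoly c * g)`_p = \sum_(s < t) c 0 s * ('X^s * g)`_p.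
    have -> : rVpoly c = \sum_(s < t) c 0 s *: 'X^s.
      rewrite /rVpoly poly_def; apply: eq_bigr => s _; rewrite valK //.
    by rewrite mulr_suml coef_sum; apply: eq_bigr => s _; rewrite -scalerAl coefZ.
  rewrite !coefE; congr (_ + _); apply: eq_bigr => s _; rewrite mxE; congr (_ * _).
    by rewrite wcoef_unit_word.
  by rewrite wcoef_unit_word.
move=> j' j'j; rewrite big1 // => s _.
have w0 (g : 'rV[{poly F}]_m) : wcoef g (word (unit_word (Ordinal pl) i j)) j' s = 0.
  rewrite /wcoef big1 // => i' _; rewrite big1 // => e _; rewrite nth_word.
  case: insubP => [p' _ _|_]; last by rewrite mxE mulr0.
  by rewrite /= ffunE; case: ifP => _; rewrite !mxE ?(negbTE j'j) ?andbF mulr0.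
by rewrite !w0 !mulr0 addr0.
Qed.

End Words.
End PairCount.

(** * Coverings and Hausdorff dimension *)

Local Open Scope classical_set_scope.
Local Open Scope ring_scope.

Section Coverable.
Variables (R : realType) (T : Type) (d : T -> T -> R).

(** An actual cover, rather than a bound on the infimum in [Hcontent], so that covers can be
    combined. *)
Definition coverable (delta s : R) (E : set T) (c : \bar R) : Prop :=
  exists U : nat -> set T,
    [/\ E `<=` \bigcup_i U i, forall i, (diamE d (U i) <= delta%:E)%E &
        (\sum_(0 <= i <oo) hterm d s (U i) <= c)%E].

Lemma hterm_ge0 s (U : set T) : (0 <= hterm d s U)%E.
Proof. by rewrite /hterm; case: ifP => // _; rewrite lee_fin powR_ge0. Qed.

Lemma diamE_set0 : diamE d set0 = -oo%E.
Proof.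
rewrite /diamE (_ : [set _ | _ in _ & _ in _] = set0) ?ereal_sup0 //.
by apply/seteqP; split => // y [].
Qed.

Lemma hterm_set0 s : hterm d s set0 = 0%E.
Proof. by rewrite /hterm asboolT. Qed.

Lemma diamE_le (U : set T) (r : R) : (forall x y, U x -> U y -> d x y <= r) ->
  (diamE d U <= r%:E)%E.
Proof.
by move=> Ur; apply: ge_ereal_sup => _ [x Ux [y Uy <-]]; rewrite lee_fin Ur.
Qed.

Lemma le_diamE (U : set T) x y : U x -> U y -> ((d x y)%:E <= diamE d U)%E.
Proof. by move=> Ux Uy; apply: ereal_sup_ubound; exists x => //; exists y. Qed.

Lemma hterm_le s (U : set T) (r : R) : 0 <= s -> 0 <= r -> (forall x, U x -> 0 <= d x x) ->
  (forall x y, U x -> U y -> d x y <= r) -> (hterm d s U <= (r `^ s)%:E)%E.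
Proof.
move=> s0 r0 d0 Ur; rewrite /hterm; case: ifPn => [_|/asboolPn U0].
  by rewrite lee_fin powR_ge0.
have /set0P[x Ux] : U != set0 by apply/eqP.
have lo : (0 <= diamE d U)%E by apply: le_trans (le_diamE Ux Ux); rewrite lee_fin d0.
have up := diamE_le Ur.
have fd : diamE d U \is a fin_num.
  by rewrite fin_numE; case: (diamE d U) lo up.
rewrite lee_fin ge0_ler_powR ?nnegrE ?fine_ge0 //.
by rewrite -lee_fin fineK.
Qed.

Lemma coverable_bigcup delta s (E : nat -> set T) (c : nat -> \bar R) :
  (forall i, coverable delta s (E i) (c i)) ->
  coverable delta s (\bigcup_i E i) (\sum_(0 <= i <oo) c i)%E.
Proof.
move=> /choice[G GP].
have /card_esym/card_set_bijP[f fbij] := card_nat2.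
exists (fun k => G (f k).1 (f k).2); split.
- move=> x [i _ /(let: And3 h _ _ := GP i in h) [j _ Gx]].
  have [_ _ /(_ (i, j) I)[k _ fk]] := fbij.
  by exists k => //; rewrite fk.
- by move=> k; have [_ h _] := GP (f k).1.
- pose a (k : nat * nat) := hterm d s (G k.1 k.2).
  rewrite nneseries_esumT; last by move=> k; exact: hterm_ge0.
  rewrite -(reindex_esum _ _ _ a fbij).
  rewrite (_ : setT = setT `*`` (fun _ : nat => setT)); last by apply/seteqP; split.
  rewrite -(@esum_esum _ _ _ setT (fun=> setT) (fun i j => hterm d s (G i j))); last first.
    by move=> *; exact: hterm_ge0.
  have c0 i : (0 <= c i)%E.
    have [_ _] := GP i; apply: le_trans; apply: nneseries_ge0 => *.
    exact: hterm_ge0.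
  rewrite nneseries_esumT //; apply: le_esum => i _.
  rewrite -nneseries_esumT; last by move=> k; exact: hterm_ge0.
  by have [_ _] := GP i.
Qed.

Lemma coverable_fin delta s (E : set T) (r : R) (J : finType) (D : J -> set T) :
  E `<=` \bigcup_w D w -> 0 <= s -> 0 <= r <= delta -> (forall x, 0 <= d x x) ->
  (forall w x y, D w x -> D w y -> d x y <= r) ->
  coverable delta s E (#|J|%:R * r `^ s)%:E.
Proof.
move=> ED s0 /andP[r0 rdelta] d0 Dr.
(* Padding by empty sets is free: their [hterm] is 0 at every exponent. *)
pose U i : set T := if insub i is Some i' then D (enum_val (i' : 'I_#|J|)) else set0.
have Ur i x y : U i x -> U i y -> d x y <= r.
  by rewrite /U; case: insubP => // ? _ _; exact: Dr.
exists U; split.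
- move=> x /ED[w _ Dx]; exists (enum_rank w : nat) => //.
  by rewrite /U valK enum_rankK.
- by move=> i; apply: diamE_le => x y Ux Uy; apply: le_trans rdelta; exact: Ur Ux Uy.
- rewrite (nneseries_split _ #|J|); last by move=> *; exact: hterm_ge0.
  rewrite add0n [X in (_ + X)%E]eseries0 ?adde0; last first.
    by move=> i iJ _; rewrite /U insubF ?hterm_set0 // ltnNge iJ.
  apply: (@le_trans _ _ (\sum_(0 <= i < #|J|) (r `^ s)%:E)%E).
    by apply: lee_sum => i _; apply: hterm_le => //; exact: Ur.
  by rewrite sumEFin lee_fin big_mkord sumr_const card_ord mulr_natl.
Qed.

Lemma dimH_le (E : set T) (s : R) : 0 <= s ->
  (forall delta eps, 0 < delta -> 0 < eps -> coverable delta s E eps%:E) ->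
  (dimH d E <= s%:E)%E.
Proof.
move=> s0 cov; apply: ereal_inf_lbound; exists s => //; split => //.
have Hc0 delta : (0 <= Hcontent d delta s E)%E.
  apply: le_ereal_inf_tmp => _ [U _ <-]; apply: nneseries_ge0 => *.
  exact: hterm_ge0.
apply/eqP; rewrite eq_le; apply/andP; split.
  apply: ge_ereal_sup => _ [delta /= delta0 <-].
  apply/lee_addgt0Pr => eps eps0; rewrite add0e.
  have [U [EU Ud Us]] := cov _ _ delta0 eps0.
  by apply: le_trans Us; apply: ereal_inf_lbound; exists U.
by apply: le_trans (Hc0 1) _; apply: ereal_sup_ubound; exists 1 => //=.
Qed.

Lemma le_dimH (E : set T) (t : R) :
  (forall s, 0 <= s -> s < t -> exists delta eps,
     [/\ 0 < delta, 0 < eps & ~ coverable delta s E eps%:E]) ->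
  (t%:E <= dimH d E)%E.
Proof.
move=> ncov; apply: le_ereal_inf_tmp => _ [s [s0 Hs] <-].
rewrite lee_fin leNgt; apply/negP => st.
have [delta [eps [delta0 eps0 []]]] := ncov s s0 st.
have : (Hcontent d delta s E < eps%:E)%E.
  apply: (@le_lt_trans _ _ 0%E); last by rewrite lte_fin.
  by rewrite -Hs; apply: ereal_sup_ubound; exists delta.
move=> /ereal_inf_lt[_ [U [EU Ud] <-]] /ltW Us.
by exists U.
Qed.

End Coverable.

(** * Laurent series *)

Section LaurentNorm.
Variables (F : finFieldType) (R : realType).
Local Notation k := (kF F R).

Lemma kF_gt1 : 1 < k.
Proof. by rewrite /kF ltr1n; apply: finNzRing_gt1. Qed.

Lemma kF_gt0 : 0 < k. Proof. exact: lt_trans ltr01 kF_gt1. Qed.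

Lemma absL_le (f : int -> F) (N : int) : (forall t, N < t -> f t = 0) -> absL R f <= k ^ N.
Proof.
move=> fN; rewrite /absL; set S := [set _ | _ in _].
(* The zero series has an empty set of exponents, on which [sup] is 0. *)
have [->|S0] := eqVneq S set0; first by rewrite sup0 exprz_ge0 // ltW // kF_gt0.
apply: ge_sup; first exact/set0P.
move=> _ [t /= ft <-]; rewrite ler_eXz2l ?kF_gt1 // leNgt.
by apply: contra_neqN ft => /fN.
Qed.

Lemma absL_lt (f : int -> F) (N : int) : is_laurent f -> absL R f < k ^ N ->
  forall t, N <= t -> f t = 0.
Proof.
move=> [M fM] fN t Nt; apply/eqP; apply: contraTT fN => ft.
rewrite -leNgt; apply: (@le_trans _ _ (k ^ t)).
  by rewrite ler_eXz2l ?kF_gt1.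
apply: ub_le_sup; last by exists t.
exists (k ^ M) => _ [u /= fu <-]; rewrite ler_eXz2l ?kF_gt1 // leNgt.
by apply: contra_neqN fu => /fM.
Qed.

Lemma normInf_lt n (v : 'I_n -> int -> F) (x : R) : normInf R v < x ->
  forall j, absL R (v j) < x.
Proof. by move=> vx j; apply: le_lt_trans vx; exact: le_bigmax. Qed.

Lemma normInf_le n (v : 'I_n -> int -> F) (x : R) : 0 <= x ->
  (forall j, absL R (v j) <= x) -> normInf R v <= x.
Proof. by move=> x0 vx; apply: bigmax_le. Qed.

Lemma normInf_ge0 n (v : 'I_n -> int -> F) : 0 <= normInf R v.
Proof. exact: bigmax_ge_id. Qed.

Lemma absL_polyL (p : {poly F}) : p != 0 -> absL R (polyL p) = k ^+ (size p).-1.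
Proof.
move=> p0; apply/eqP; rewrite eq_le; apply/andP; split.
  apply: (@absL_le _ (Posz _)) => -[e|e] // pe /=; rewrite nth_default //.
  by move: p0 pe; rewrite -size_poly_gt0 ltz_nat; case: (size p).
apply: ub_le_sup; last by exists (Posz (size p).-1); rewrite //= -lead_coefE lead_coef_eq0.
exists (k ^+ (size p).-1) => _ [[e|e] /= pe <-]; last by rewrite eqxx in pe.
rewrite -exprnP ler_eXn2l ?kF_gt1 //.
have : (e < size p)%N by rewrite ltnNge; apply: contra_neqN pe => /(nth_default 0).
by case: (size p).
Qed.

Lemma absL_polyL0 : absL R (polyL (0 : {poly F})) = 0.
Proof.
rewrite /absL (_ : [set _ | _ in _] = set0) ?sup0 //.
by apply/seteqP; split => // _ [[e|e] /= + _]; rewrite ?coef0 eqxx.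
Qed.

Section Vectors.
Variable m : nat.
Implicit Type q : 'rV[{poly F}]_m.

(* The junk value of the degree at [q = 0] is [0]. *)
Definition degq q : nat := (\max_(i < m) size (q ord0 i)).-1.

Lemma size_degq q i : (size (q ord0 i) <= (degq q).+1)%N.
Proof. by apply: leq_trans (leqSpred _); exact: leq_bigmax. Qed.

Lemma degq_attained q : q != 0 -> exists i, size (q ord0 i) = (degq q).+1.
Proof.
move=> q0; have /existsP[i qi] : [exists i, q ord0 i != 0].
  apply: contraNT q0; rewrite negb_exists => /forallP q0.
  by apply/eqP/rowP => i; rewrite mxE; apply/eqP; rewrite -[_ == _]negbK q0.
have m0 : (0 < m)%N := leq_ltn_trans (leq0n i) (ltn_ord i).
have [|i0 _ ei0] := @eq_bigmax_cond _ xpredT (fun i => size (q ord0 i)).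
  by rewrite card_ord.
exists i0; rewrite /degq ei0 prednK // -ei0.
by apply: leq_trans (leq_bigmax i); rewrite size_poly_gt0.
Qed.

Lemma normP_deg q : q != 0 -> normP R q = k ^+ degq q.
Proof.
move=> q0; apply/eqP; rewrite eq_le; apply/andP; split.
  apply: bigmax_le => [|i _]; first by rewrite exprn_ge0 // ltW // kF_gt0.
  have [->|qi] := eqVneq (q ord0 i) 0.
    by rewrite absL_polyL0 exprn_ge0 // ltW // kF_gt0.
  rewrite absL_polyL // ler_eXn2l ?kF_gt1 //.
  by have := size_degq q i; case: (size _).
have [i qi] := degq_attained q0.
apply: le_trans (le_bigmax _ _ i).
by rewrite absL_polyL ?qi // -size_poly_gt0 qi.
Qed.

Lemma qmul_eq0 n q (A : 'I_m -> 'I_n -> laurent F) (N : int) j (t : int) :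
  (forall i u, N <= u -> sval (A i j) u = 0) -> N + (degq q)%:Z <= t ->
  qmul q A j t = 0.
Proof.
move=> A0 Nt; rewrite /qmul big1 // => i _; rewrite big1 // => e _.
rewrite A0 ?mulr0 // lerBrDr; apply: le_trans Nt; rewrite lerD2l lez_nat -ltnS.
exact: leq_trans (ltn_ord e) (size_degq q i).
Qed.

Lemma laurent_bound n (A : 'I_m -> 'I_n -> laurent F) :
  exists N : nat, forall i j t, N%:Z <= t -> sval (A i j) t = 0.
Proof.
have /choice[g gP] : forall ij : 'I_m * 'I_n, exists N : nat, forall t, N%:Z <= t -> sval (A ij.1 ij.2) t = 0.
  move=> [i j] /=; have [N NP] := svalP (A i j).
  by exists (`|N|.+1)%N => t Nt; apply: NP; lia.
exists (\max_ij g ij) => i j t Nt; apply: (gP (i, j)).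
by apply: le_trans Nt; rewrite lez_nat; exact: (@leq_bigmax _ g).
Qed.

Lemma distZ_lt n q (A : 'I_m -> 'I_n -> laurent F) (r : int) :
  distZ R (qmul q A) < k ^ r ->
  forall j t, r <= t -> t < 0 -> qmul q A j t = 0.
Proof.
move=> /inf_lt => /(_ _)[|_ [p _ <-] pr j t rt t0].
  by exists (normInf R (fun j t => qmul q A j t - polyL (0 : {poly F}) t)), (fun=> 0).
have := absL_lt _ (normInf_lt pr j) rt.
rewrite /polyL; case: t t0 {rt} => // t _; rewrite subr0; apply.
have [N NA] := laurent_bound A.
exists ((N + degq q)%N%:Z + (size (p j))%:Z) => u uN.
rewrite (@qmul_eq0 _ _ _ N%:Z); last 2 first.
- by move=> *; exact: NA.
- by apply: ltW; apply: le_lt_trans uN; rewrite PoszD lerDl.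
rewrite sub0r; case: u uN => u uN /=; rewrite ?oppr0 //.
rewrite nth_default ?oppr0 //.
by move: uN; rewrite -PoszD ltz_nat => /ltnW; exact: leq_trans (leq_addl _ _).
Qed.

Lemma distZ_le n q (A : 'I_m -> 'I_n -> laurent F) (r : int) :
  (forall j t, r < t -> t < 0 -> qmul q A j t = 0) -> distZ R (qmul q A) <= k ^ r.
Proof.
move=> qA0; have [N NA] := laurent_bound A.
(* The polynomial part of [qA], whose degrees lie below [N + degq q]. *)
pose p j : {poly F} := \poly_(e < N + degq q) qmul q A j e%:Z.
apply: (@le_trans _ _ (normInf R (fun j t => qmul q A j t - polyL (p j) t))).
  apply: ge_inf; last by exists p.
  by exists 0 => _ [p' _ <-]; exact: normInf_ge0.
apply: normInf_le => [|j]; first by rewrite exprz_ge0 // ltW // kF_gt0.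
apply: absL_le => -[t|t] rt; last by rewrite subr0 qA0.
rewrite /= coef_poly; case: ltnP => tN; first by rewrite subrr.
by rewrite (@qmul_eq0 _ _ _ N%:Z) ?subrr // => *; exact: NA.
Qed.

Lemma distZ_ge0 n (v : 'I_n -> int -> F) : 0 <= distZ R v.
Proof.
apply: lb_le_inf => [|_ [p _ <-]]; last exact: normInf_ge0.
by exists (normInf R (fun j t => v j t - polyL (0 : {poly F}) t)), (fun=> 0).
Qed.

Lemma distM_le n (A B : 'I_m -> 'I_n -> laurent F) (r : int) :
  (forall i j t, r < t -> sval (A i j) t = sval (B i j) t) ->
  distM R A B <= k ^ r.
Proof.
move=> AB; have k0 : 0 <= k ^ r by rewrite exprz_ge0 // ltW // kF_gt0.
apply: bigmax_le => // i _; apply: bigmax_le => // j _.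
by apply: absL_le => t /AB ->; rewrite subrr.
Qed.

Lemma distM_lt n (A B : 'I_m -> 'I_n -> laurent F) (r : int) :
  distM R A B < k ^ r ->
  forall i j t, r <= t -> sval (A i j) t = sval (B i j) t.
Proof.
move=> AB i j t rt; apply/eqP; rewrite -subr_eq0; apply/eqP.
have [N NA] := svalP (A i j); have [M MB] := svalP (B i j).
apply: (@absL_lt (fun t => sval (A i j) t - sval (B i j) t) r _ _ t rt).
  by exists (Num.max N M) => u; rewrite gt_max => /andP[uN uM]; rewrite NA // MB // subrr.
apply: le_lt_trans AB; apply: le_trans (le_bigmax _ _ i).
exact: (le_bigmax _ (fun j => absL R (fun t0 : int => sval (A i j) t0 - sval (B i j) t0))).
Qed.

Lemma distM_ge0 n (A B : 'I_m -> 'I_n -> laurent F) : 0 <= distM R A B.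
Proof. exact: bigmax_ge_id. Qed.

End Vectors.
End LaurentNorm.

(** * The upper bound *)

Section Covers.
Variables (F : finFieldType) (R : realType) (m n : nat).
Local Notation k := (kF F R).
Local Notation mat := ('I_m -> 'I_n -> laurent F).
Implicit Types (q : 'rV[{poly F}]_m) (A : mat).

Definition box (N : nat) : set mat :=
  [set A | forall i j t, N%:Z <= t -> sval (A i j) t = 0].

(** In degree [t + degq q] the product sees the entry of row [i0] at degree [t] through a nonzero
    leading coefficient; all other contributions are already known to agree and cancel. *)
Lemma qmul_leading q A A' i0 j (t : int) :
  size (q ord0 i0) = (degq q).+1 ->
  (forall i u, i != i0 -> t <= u -> sval (A i j) u = sval (A' i j) u) ->
  (forall u, t < u -> sval (A i0 j) u = sval (A' i0 j) u) ->
  qmul q A j (t + (degq q)%:Z) = qmul q A' j (t + (degq q)%:Z) ->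
  sval (A i0 j) t = sval (A' i0 j) t.
Proof.
move=> q0 Ai Ai0; rewrite /qmul !(bigD1 i0 (P := xpredT)) //=.
rewrite [X in _ + X = _](eq_bigr (fun i => \sum_(e < size (q ord0 i))
  (q ord0 i)`_e * sval (A' i j) (t + degq q - e%:Z))); last first.
  move=> i ii0; apply: eq_bigr => e _; rewrite Ai // -addrA lerDl subr_ge0 lez_nat.
  by rewrite -ltnS; exact: leq_trans (ltn_ord e) (size_degq q i).
move=> /addIr; rewrite -!(big_mkord xpredT (fun e => (q ord0 i0)`_e * sval (_ i0 j) (_ - e%:Z))).
rewrite q0 !big_nat_recr //= !big_mkord.
rewrite [X in X + _ = _](eq_bigr (fun e : 'I__ => (q ord0 i0)`_e *
  sval (A' i0 j) (t + degq q - e%:Z))); last first.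
  by move=> e _; rewrite Ai0 // -addrA ltrDl subr_gt0 ltz_nat.
move=> /addrI; rewrite addrK; apply: mulfI.
by rewrite -[degq q]/((degq q).+1.-1) -q0 -lead_coefE lead_coef_eq0 -size_poly_gt0 q0.
Qed.

Definition digits N L A : {ffun 'I_m * 'I_n * 'I_(N + L) -> F} :=
  [ffun x : 'I_m * 'I_n * 'I_(N + L) => sval (A x.1.1 x.1.2) (x.2%:Z - L%:Z)].

Lemma kF_natX e : (#|F| ^ e)%N%:R = k ^+ e.
Proof. by rewrite natrX. Qed.

Lemma coverable_digits (J : finType) (D : J -> set mat) (E : set mat) delta s (L : nat) :
  0 <= s -> k ^- L.+1 <= delta -> (forall A, E A -> exists w, D w A) ->
  (forall w A A', D w A -> D w A' ->
     forall i j t, - L%:Z <= t -> sval (A i j) t = sval (A' i j) t) ->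
  coverable (@distM F R m n) delta s E (#|J|%:R * (k ^- L.+1) `^ s)%:E.
Proof.
move=> s0 Ldelta ED Dagree; apply: (@coverable_fin _ _ _ _ _ _ _ _ D) => //.
- by move=> A /ED[w Dw]; exists w.
- by rewrite Ldelta invr_ge0 exprn_ge0 // ltW // kF_gt0.
- by move=> A; exact: distM_ge0.
- move=> w A A' DA DA'; have -> : k ^- L.+1 = k ^ (- L.+1%:Z) by rewrite exprnN.
  apply: distM_le => i j t Lt; apply: (Dagree w) => //.
  by move: Lt; rewrite -addn1 PoszD opprD => ?; lia.
Qed.

Lemma coverable_box N L delta s : 0 <= s -> k ^- L.+1 <= delta ->
  coverable (@distM F R m n) delta s (box N)
    (k ^+ (m * n * (N + L)) * (k ^- L.+1) `^ s)%:E.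
Proof.
move=> s0 Ldelta.
pose D (w : {ffun 'I_m * 'I_n * 'I_(N + L) -> F}) : set mat :=
  [set A | box N A /\ digits N L A = w].
have := @coverable_digits _ D (box N) delta s L s0 Ldelta.
rewrite card_ffun !card_prod !card_ord kF_natX; apply.
  by move=> A NA; exists (digits N L A).
move=> w A A' [NA <-] [NA' /ffunP AA'] i j t Lt.
have [tN|Nt] := ltP t N%:Z; last by rewrite NA // NA'.
have tNL : ((absz (t + L%:Z)%R) < N + L)%N by lia.
have := AA' (i, j, Ordinal tNL); rewrite !ffunE /=.
by have -> : (absz (t + L%:Z)%R)%:Z - L%:Z = t by lia.
Qed.

Definition strip q (r : int) : set mat :=
  [set A | forall j t, - r <= t -> t < 0 -> qmul q A j t = 0].

Lemma coverable_strip q N L (r : int) delta s :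
  q != 0 -> L%:Z = (degq q)%:Z + r -> 0 <= s -> k ^- L.+1 <= delta ->
  coverable (@distM F R m n) delta s (box N `&` strip q r)
    (k ^+ (n * (N + degq q) + m.-1 * n * (N + L)) * (k ^- L.+1) `^ s)%:E.
Proof.
move=> q0 Lr s0 Ldelta; have [i0 qi0] := degq_attained q0.
pose W := {ffun 'I_n * 'I_(N + degq q) -> F}.
pose B := {ffun 'I_m.-1 * 'I_n * 'I_(N + L) -> F}.
pose w A : W := [ffun x : 'I_n * 'I_(N + degq q) => qmul q A x.1 x.2%:Z].
pose b A : B := [ffun x : 'I_m.-1 * 'I_n * 'I_(N + L) => sval (A (lift i0 x.1.1) x.1.2) (x.2%:Z - L%:Z)].
pose D (wb : W * B) : set mat :=
  [set A | [/\ box N A, strip q r A & (w A, b A) = wb]].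
have := @coverable_digits _ D (box N `&` strip q r) delta s L s0 Ldelta.
rewrite card_prod !card_ffun !card_prod !card_ord -expnD kF_natX; apply.
  by move=> A [NA rA]; exists (w A, b A).
move=> _ A A' [NA rA <-] [NA' rA' [/ffunP wAA' /ffunP bAA']].
have Ai i j u : i != i0 -> - L%:Z <= u -> sval (A i j) u = sval (A' i j) u.
  rewrite eq_sym => ii0 Lu; have [uN|Nu] := ltP u N%:Z; last by rewrite NA // NA'.
  have [i' -> _] := unlift_some ii0.
  have uNL : ((absz (u + L%:Z)%R) < N + L)%N by lia.
  have := bAA' (i', j, Ordinal uNL); rewrite !ffunE /=.
  by have -> : (absz (u + L%:Z)%R)%:Z - L%:Z = u by lia.
(* Descending recursion on the degree: [c] bounds the number of steps down from [N], from which on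
   both matrices vanish. *)
have Ai0 j c u : - L%:Z <= u -> N%:Z - c%:Z <= u -> sval (A i0 j) u = sval (A' i0 j) u.
  elim: c u => [|c IHc] u Lu Nu; first by rewrite NA ?NA' //; lia.
  have [Nu'|uN] := leP (N%:Z - c%:Z) u; first exact: IHc.
  apply: (qmul_leading qi0) => [i v ii0 uv|v uv|].
  - by apply: Ai => //; lia.
  - by apply: IHc; lia.
  (* In negative degrees both products vanish by the strip condition, which reaches exactly down to
     [u = -L]; in the others they agree by the recorded polynomial part [w]. *)
  have [ud|ud] := ltP (u + (degq q)%:Z) 0.
    by rewrite rA ?rA' //; lia.
  have uNd : ((absz (u + (degq q)%:Z)%R) < N + degq q)%N by lia.
  have := wAA' (j, Ordinal uNd); rewrite !ffunE /=.
  by rewrite gez0_abs.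
move=> i j t Lt; have [->|] := eqVneq i i0; last by move=> ?; exact: Ai.
by apply: (Ai0 j (absz (N%:Z - t))%R) => //; lia.
Qed.

End Covers.

Lemma coverable_sub (R : realType) (T : Type) (d : T -> T -> R) delta delta' s
  (E E' : set T) (c c' : \bar R) :
  E `<=` E' -> delta' <= delta -> (c' <= c)%E -> coverable d delta' s E' c' ->
  coverable d delta s E c.
Proof.
move=> EE' dd' cc' [U [E'U Ud Us]]; exists U; split.
- exact: subset_trans E'U.
- by move=> i; apply: le_trans (Ud i) _; rewrite lee_fin.
- exact: le_trans cc'.
Qed.

Lemma powR_gt1 (R : realType) (a x : R) : 1 < a -> 0 < x -> 1 < a `^ x.
Proof.
move=> a1 x0; apply: (@le_lt_trans _ _ (1 `^ x)); first by rewrite powR1.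
by rewrite gt0_ltr_powR ?nnegrE // ltW // (lt_trans ltr01).
Qed.

Section EsumCountable.
Variables (R : realType) (T : countType) (P : set T) (a : T -> \bar R).
Hypothesis a0 : forall x, P x -> (0 <= a x)%E.

(** The family laid out along the codes of [T], which turns [esum] into a series with tails. *)
Definition pickled (i : nat) : \bar R :=
  if pickle_inv i is Some x then (if x \in P then a x else 0%E) else 0%E.

Lemma pickled_ge0 i : (0 <= pickled i)%E.
Proof.
rewrite /pickled; case: (pickle_inv i) => // x; case: ifP => // /set_mem.
exact: a0.
Qed.

Lemma pickledE x : P x -> pickled (pickle x) = a x.
Proof. by move=> Px; rewrite /pickled pickleK_inv mem_set. Qed.

Lemma esum_pickled : (\esum_(x in P) a x = \sum_(0 <= i <oo) pickled i)%E.
Proof.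
rewrite nneseries_esumT; last exact: pickled_ge0.
pose Q := pickle @` P.
have bijQ : set_bij P Q pickle.
  split=> [x Px|x y _ _ /(pcan_inj pickleK)//|//]; first by exists x.
rewrite (_ : \esum_(i in setT) pickled i = \esum_(i in Q) pickled i)%E.
  by rewrite (reindex_esum _ _ _ _ bijQ); apply: eq_esum => x Px; rewrite pickledE.
rewrite [RHS]esum_mkcond; apply: eq_esum => i _; case: ifPn => // /negP iQ.
rewrite /pickled; case E: (pickle_inv i) => [x|//]; case: ifP => // /set_mem Px.
case: iQ; apply: mem_set; exists x => //.
by have := @pickle_invK T i; rewrite E.
Qed.

Lemma esum_tail (eps : R) : (\esum_(x in P) a x < +oo)%E -> 0 < eps ->
  exists M : nat, (\sum_(M <= i <oo) pickled i <= eps%:E)%E.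
Proof.
rewrite esum_pickled => /nneseries_tail_cvg /(_ (fun k _ => pickled_ge0 k)).
move=> /fine_cvgP[[M1 _ fin1] /cvgr_lt /(_ eps)] /[swap] eps0 /(_ eps0)[M2 _ lt2].
exists (maxn M1 M2); rewrite -[leLHS]fineK; last by apply: fin1; exact: leq_maxl.
by rewrite lee_fin ltW //; apply: lt2; exact: leq_maxr.
Qed.

Lemma pickled_le_tail M i : (M <= i)%N ->
  (pickled i <= \sum_(M <= j <oo) pickled j)%E.
Proof.
move=> /subnK <-; rewrite -nneseries_addn; last exact: pickled_ge0.
apply: le_trans (nneseries_lim_ge (i - M).+1 _); last by move=> *; exact: pickled_ge0.
rewrite big_mkord big_ord_recr /= leeDr // sume_ge0 // => *; exact: pickled_ge0.
Qed.

End EsumCountable.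

Lemma finite_pickle_lt (T : countType) (M : nat) : finite_set [set x : T | (pickle x < M)%N].
Proof.
have [[x0]|noT] := pselect (inhabited T); last first.
  apply: (@sub_finite_set _ _ set0) => // x _; exact: noT (inhabits x).
apply: (@sub_finite_set _ _ ((fun i => odflt x0 (pickle_inv i)) @` `I_M)).
  by move=> x /= xM; exists (pickle x); rewrite ?pickleK_inv.
by apply: finite_image; exact: finite_II.
Qed.

Section Upper.
Variables (F : finFieldType) (R : realType) (m n : nat).
Variable psi : 'rV[{poly F}]_m -> R.
Local Notation k := (kF F R).
Hypothesis psi_val : forall q, psi q = 0 \/ exists r : int, psi q = k ^ r.

Definition eta_term (e : R) (q : 'rV[{poly F}]_m) : R :=
  normP R q ^+ n * (psi q / normP R q) `^ e.

Lemma kF_small (x : R) : 0 < x -> exists L : nat, k ^- L <= x.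
Proof.
move=> x0; have y0 : 0 < k - 1 by rewrite subr_gt0 kF_gt1.
have yi : 0 <= (x * (k - 1))^-1 by rewrite invr_ge0 ltW // mulr_gt0.
have [L] : exists L : nat, (x * (k - 1))^-1 < L%:R.
  by exists (Num.Def.archi_bound (x * (k - 1))^-1); exact: archi_boundP.
rewrite -(ltr_pM2r y0) invfM -mulrA mulVf ?gt_eqF // mulr1 => /ltW h; exists L.
rewrite -[x]invrK lef_pV2 ?posrE ?invr_gt0 ?exprn_gt0 ?kF_gt0 //.
by apply: le_trans (bernoulli_le _ (ltW (kF_gt1 F R))); apply: le_trans h _; rewrite lerDr.
Qed.

Lemma kF_powR_mul (c L : nat) (s : R) :
  k ^+ (c * L) * (k ^- L) `^ s = (k ^- L) `^ (s - c%:R).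
Proof.
have L0 : 0 < k ^- L by rewrite invr_gt0 exprn_gt0 // kF_gt0.
have -> : (k ^- L) `^ (s - c%:R) = (k ^- L) `^ s / (k ^- L) `^ c%:R.
  by apply: powRB; rewrite (gt_eqF L0) implybT.
rewrite [X in _ = _ / X]powR_mulrn ?ltW // mulrC.
by rewrite exprVn invrK -exprM mulnC.
Qed.

Lemma kF_powR_small (C a x : R) : 0 < C -> 0 < a -> 0 < x ->
  exists y, 0 < y /\ forall z, 0 <= z -> z <= y -> C * z `^ a <= x.
Proof.
move=> C0 a0 x0; exists ((x / C) `^ a^-1); split; first by rewrite powR_gt0 ?divr_gt0.
move=> z z0 zy; rewrite mulrC -ler_pdivlMr //.
apply: (@le_trans _ _ (((x / C) `^ a^-1) `^ a)).
  by rewrite ge0_ler_powR ?nnegrE ?powR_ge0 // ltW.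
by rewrite -powRrM mulVf ?gt_eqF // powRr1 // divr_ge0 // ltW.
Qed.

Lemma psi_ge0 q : 0 <= psi q.
Proof. by have [->|[r ->]] := psi_val q; rewrite ?exprz_ge0 // ltW // kF_gt0. Qed.

Lemma normP_ge1 (q : 'rV[{poly F}]_m) : q != 0 -> 1 <= normP R q.
Proof. by move=> q0; rewrite normP_deg // exprn_ege1 // ltW // kF_gt1. Qed.

Lemma eta_term_ge0 e q : 0 <= eta_term e q.
Proof. by rewrite mulr_ge0 ?powR_ge0 // exprn_ge0 // bigmax_ge_id. Qed.

Lemma box_cover : [set: 'I_m -> 'I_n -> laurent F] `<=` \bigcup_N box N.
Proof. by move=> A _; have [N NA] := laurent_bound A; exists N. Qed.

Lemma coverable_boxes (E : set ('I_m -> 'I_n -> laurent F)) delta s eps : 0 < eps ->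
  (forall N eps, 0 < eps -> coverable (@distM F R m n) delta s (E `&` box N) eps%:E) ->
  coverable (@distM F R m n) delta s E eps%:E.
Proof.
move=> eps0 covN.
have h : coverable (@distM F R m n) delta s (\bigcup_N (E `&` box N))
    (\sum_(0 <= N <oo) (eps / (2 ^ N.+1)%:R)%:E)%E.
  by apply: coverable_bigcup => N; apply: covN; rewrite divr_gt0 // ltr0n expn_gt0.
apply: coverable_sub (epsilon_trick0 xpredT (ltW eps0)) h => // A EA.
by have [N _ NA] := box_cover (I : setT A); exists N.
Qed.

(** A box is covered by [k^(mn(N+L))] sets of diameter below [k^-L], so the whole space has
    dimension at most [mn]; this accounts for the term [n] in the minimum. *)
Lemma coverable_large (s delta eps : R) : (m * n)%:R < s -> 0 < delta -> 0 < eps ->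
  coverable (@distM F R m n) delta s (@Wset F R m n psi) eps%:E.
Proof.
move=> mns delta0 eps0; apply: coverable_boxes => // N {}eps {}eps0.
have s0 : 0 <= s by apply: le_trans (ltW mns); rewrite ler0n.
pose C := k ^+ (m * n * N).
have C0 : 0 < C by rewrite exprn_gt0 // kF_gt0.
have sm0 : 0 < s - (m * n)%:R by rewrite subr_gt0.
have [y [y0 yP]] := kF_powR_small C0 sm0 eps0.
have [L Ly] : exists L : nat, k ^- L <= Num.min y delta.
  by apply: kF_small; rewrite lt_min y0.
move: Ly; rewrite le_min => /andP[Ly Ld].
have L0 : 0 <= k ^- L by rewrite invr_ge0 exprn_ge0 // ltW // kF_gt0.
have LS : k ^- L.+1 <= k ^- L.
  by rewrite lef_pV2 ?posrE ?exprn_gt0 ?kF_gt0 // ler_weXn2l // ltW // kF_gt1.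
apply: coverable_sub (@coverable_box F R m n N L delta s s0 _).
- exact: subIsetr.
- exact: lexx.
- rewrite lee_fin; apply: le_trans (yP _ L0 Ly).
  rewrite mulnDr exprD -mulrA; apply: ler_wpM2l; rewrite ?(ltW C0) // -kF_powR_mul.
  apply: ler_wpM2l; first by rewrite exprn_ge0 // ltW // kF_gt0.
  by rewrite ge0_ler_powR ?nnegrE // invr_ge0 exprn_ge0 // ltW // kF_gt0.
- exact: le_trans Ld.
Qed.

End Upper.

Section EtaUpper.
Variables (F : finFieldType) (R : realType) (m n : nat).
Variable psi : 'rV[{poly F}]_m -> R.
Local Notation k := (kF F R).
Hypothesis psi_val : forall q, psi q = 0 \/ exists r : int, psi q = k ^ r.
Local Notation term := (eta_term n psi).
Local Notation esumt e :=
  (\esum_(q in [set q : 'rV[{poly F}]_m | q != 0%R]) (term e q)%:E)%E.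

Lemma coverable_eta_strip (N : nat) (delta s : R) (q : 'rV[{poly F}]_m) :
  (0 < m)%N -> q != 0 -> 0 < psi q -> 0 <= s ->
  psi q / normP R q < 1 -> psi q / normP R q <= delta ->
  coverable (@distM F R m n) delta s
    ([set A | distZ R (qmul q A) < psi q] `&` box N)
    (k ^+ (n * N + m.-1 * n * N) * term (s - (m.-1 * n)%:R) q)%:E.
Proof.
move=> m0 q0 psi0 s0; have [psiq|[r psiq]] := psi_val q.
  by rewrite psiq ltxx in psi0.
have kr : psi q / normP R q = k ^ (r - (degq q)%:Z).
  by rewrite psiq normP_deg // expfzDr ?gt_eqF ?kF_gt0 // exprnN.
rewrite /eta_term kr => lt1 led.
have rd : r - (degq q)%:Z < 0.
  by rewrite -(ltr_eXz2l (kF_gt1 F R)) expr0z.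
(* Here [psi q = k^r], the sign of [r] being opposite to that in [coverable_strip]; as the ratio is
   below 1, [degq q - r] is a natural number. *)
have [L LE] : exists L : nat, L%:Z = (degq q)%:Z + - r.
  by exists (absz ((degq q)%:Z - r)%R); lia.
have krL : k ^ (r - (degq q)%:Z) = k ^- L.
  by rewrite exprnN LE opprD opprK addrC.
rewrite krL in led *.
have k0 := kF_gt0 F R.
have L0 : 0 <= k ^- L by rewrite invr_ge0 exprn_ge0 // ltW.
have LS : k ^- L.+1 <= k ^- L.
  by rewrite lef_pV2 ?posrE ?exprn_gt0 // ler_weXn2l // ltW // kF_gt1.
apply: coverable_sub (@coverable_strip F R m n q N L (- r) delta s q0 LE s0 _).
- move=> A [/= qA NA]; split => // j t rt t0.
  by rewrite psiq in qA; apply: (distZ_lt qA) => //; rewrite -[r]opprK.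
- exact: lexx.
- rewrite lee_fin normP_deg // -exprM -kF_powR_mul.
  rewrite [leRHS](_ : _ = k ^+ (n * (N + degq q) + m.-1 * n * (N + L)) * (k ^- L) `^ s).
    apply: ler_wpM2l; first by rewrite exprn_ge0 // ltW.
    by rewrite ge0_ler_powR ?nnegrE // invr_ge0 exprn_ge0 // ltW.
  by rewrite !mulrA -!exprD; congr (k ^+ _ * _); lia.
- exact: le_trans led.
Qed.

(** Raising the exponent costs only a constant, because [psi q / normP q] is at most [B]. *)
Lemma eta_term_mono (B e0 e : R) q : (forall q, psi q <= B) -> 1 <= B ->
  e0 <= e -> q != 0 -> 0 < psi q -> term e q <= B `^ (e - e0) * term e0 q.
Proof.
move=> psiB B1 e0e q0 psi0; rewrite /eta_term mulrCA.
have qn0 := normP_ge1 R q0.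
have x0 : 0 < psi q / normP R q by rewrite divr_gt0 // (lt_le_trans ltr01).
apply: ler_wpM2l; first by rewrite exprn_ge0 // (le_trans ler01).
have -> : (psi q / normP R q) `^ e = (psi q / normP R q) `^ (e - e0) * (psi q / normP R q) `^ e0.
  by rewrite -powRD ?subrK // (gt_eqF x0) implybT.
apply: ler_wpM2r; first exact: powR_ge0.
rewrite ge0_ler_powR ?nnegrE ?subr_ge0 // ?(ltW x0) ?(le_trans ler01 B1) //.
apply: le_trans (psiB q); rewrite ler_pdivrMr ?(lt_le_trans ltr01) //.
by rewrite ler_peMr // ltW.
Qed.

Lemma coverable_eta (B e0 s delta eps : R) :
  (0 < m)%N -> (forall q, psi q <= B) -> 0 < e0 -> 0 <= s ->
  e0 <= s - (m.-1 * n)%:R -> (esumt e0 < +oo)%E -> 0 < delta -> 0 < eps ->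
  coverable (@distM F R m n) delta s (@Wset F R m n psi) eps%:E.
Proof.
move=> m0 psiB e00 s0 e0s fin delta0 eps0; apply: coverable_boxes => // N {}eps {}eps0.
wlog B1 : B psiB / 1 <= B => [hw|].
  apply: (hw (Num.max B 1)); last by rewrite le_max lexx orbT.
  by move=> q; rewrite le_max psiB.
pose e := s - (m.-1 * n)%:R.
pose C := k ^+ (n * N + m.-1 * n * N) * B `^ (e - e0).
have k0 := kF_gt0 F R.
have C0 : 0 < C by rewrite mulr_gt0 ?exprn_gt0 ?powR_gt0 // (lt_le_trans ltr01).
(* Since [normP q] is at least 1, a tail term bounded by the power [e0] of [y] forces
   [psi q / normP q <= y]. The ratio is then below 1 and at most [delta], as [coverable_eta_strip]
   requires. *)
pose y := Num.min delta (1 / 2).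
have y0 : 0 < y by rewrite lt_min delta0 divr_gt0.
pose eps1 := Num.min (eps / C) (y `^ e0).
have eps10 : 0 < eps1 by rewrite lt_min divr_gt0 //= powR_gt0.
have t0 q : [set q : 'rV[{poly F}]_m | q != 0%R] q -> (0 <= (term e0 q)%:E)%E.
  by move=> _; rewrite lee_fin eta_term_ge0.
have [M tailM] := esum_tail t0 fin eps10.
pose c := pickled [set q : 'rV[{poly F}]_m | q != 0%R] (fun q => (term e0 q)%:E).
(* Vectors with [psi q = 0] may get the empty set, since distances are nonnegative; the zero vector
   is a single solution and cannot affect infinitude. *)
pose E i : set ('I_m -> 'I_n -> laurent F) :=
  if pickle_inv i is Some q then
    if (q != 0) && (0 < psi q) then [set A | distZ R (qmul q A) < psi q] `&` box N
    else set0
  else set0.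
have c0 i : (0 <= c i)%E by exact: pickled_ge0.
have empty_cov (x : \bar R) : (0 <= x)%E -> coverable (@distM F R m n) delta s set0 x.
  move=> x0; exists (fun=> set0); split => //.
    by move=> i; rewrite diamE_set0 leNye.
  by rewrite eseries0 // => i _ _; rewrite hterm_set0.
have covE i : coverable (@distM F R m n) delta s (E (i + M)%N) (C%:E * c (i + M)%N)%E.
  have cov0 : coverable (@distM F R m n) delta s set0 (C%:E * c (i + M)%N)%E.
    by apply: empty_cov; rewrite mule_ge0 // lee_fin ltW.
  rewrite /E; case Eq : (pickle_inv (i + M)) => [q|] //; case: ifP => // /andP[q0 psi0].
  have cE : c (i + M)%N = (term e0 q)%:E.
    by rewrite /c /pickled Eq mem_set.
  have : (c (i + M)%N <= eps1%:E)%E.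
    by apply: le_trans tailM; apply: pickled_le_tail => //; rewrite leq_addl.
  rewrite cE !lee_fin => cle.
  have x0 : 0 <= psi q / normP R q by rewrite divr_ge0 ?bigmax_ge_id // ltW.
  have xy : psi q / normP R q <= y.
    rewrite leNgt; apply/negP => yx.
    have : y `^ e0 < (psi q / normP R q) `^ e0 by rewrite gt0_ltr_powR ?nnegrE // ltW.
    apply/negP; rewrite -leNgt; apply: le_trans (_ : term e0 q <= _).
      by rewrite /eta_term ler_peMl ?powR_ge0 // exprn_ege1 // normP_ge1.
    by apply: le_trans cle _; rewrite ge_min lexx orbT.
  move: xy; rewrite le_min => /andP[xd x1].
  have lt1 : psi q / normP R q < 1.
    by apply: le_lt_trans x1 _; rewrite ltr_pdivrMr // mul1r ltr1n.
  apply: coverable_sub (@coverable_eta_strip N delta s q m0 q0 psi0 s0 lt1 xd) => //.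
  rewrite -EFinM lee_fin /C -mulrA.
  apply: ler_wpM2l; first by rewrite exprn_ge0 // ltW.
  exact: eta_term_mono.
apply: coverable_sub (coverable_bigcup covE) => //.
  move=> A [WA NA].
  (* Only finitely many vectors are zero or have a code below [M], and [A] has infinitely many
     solutions. *)
  have [q [qA q0 qM]] : exists q, [/\ distZ R (qmul q A) < psi q, q != 0 & (M <= pickle q)%N].
    apply: contrapT => nq; apply: WA.
    apply: (@sub_finite_set _ _ ([set 0] `|` [set q | (pickle q < M)%N])).
      move=> q /= qA; have [->|q0] := eqVneq q 0; [by left|right => /=].
      by rewrite ltnNge; apply/negP => qM; apply: nq; exists q.
    by rewrite finite_setU; split => //; exact: finite_pickle_lt.
  exists (pickle q - M)%N => //; rewrite subnK // /E pickleK_inv q0 /=.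
  by rewrite (le_lt_trans (distZ_ge0 _ _) qA).
rewrite nneseriesZl // (nneseries_addn M) //.
apply: (@le_trans _ _ (C%:E * (eps / C)%:E)%E).
  rewrite lee_pmul2l ?lte_fin //; apply: le_trans tailM _.
  by rewrite lee_fin ge_min lexx.
by rewrite -EFinM lee_fin mulrCA divff ?mulr1 ?gt_eqF.
Qed.

End EtaUpper.

(** * The exponent eta and good scales *)

Section FewPolys.
Variables (F : finFieldType) (m : nat).

Definition polys_upto (D : nat) : seq 'rV[{poly F}]_m :=
  [seq \row_i rVpoly (row i M) | M <- enum 'M[F]_(m, D.+1)].

Lemma mem_polys_upto D q : (degq q <= D)%N -> q \in polys_upto D.
Proof.
move=> qD; apply/mapP; exists (\matrix_(i, e) (q ord0 i)`_e); first by rewrite mem_enum.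
apply/rowP => i; rewrite mxE; apply/polyP => e; rewrite coef_rVpoly.
case: insubP => [e' _ <-|]; first by rewrite !mxE.
by rewrite -leqNgt => eD; rewrite nth_default // (leq_trans (size_degq q i)) // (leq_trans _ eD).
Qed.

Lemma size_polys_upto D (Q : seq 'rV[{poly F}]_m) : uniq Q ->
  (forall q, q \in Q -> (degq q <= D)%N) -> (size Q <= #|F| ^ (m * D.+1))%N.
Proof.
move=> uQ QD; apply: leq_trans (uniq_leq_size uQ (_ : {subset Q <= polys_upto D})) _.
  by move=> q /QD; exact: mem_polys_upto.
by rewrite size_map -cardE card_mx.
Qed.

Lemma finite_degq_le D : finite_set [set q : 'rV[{poly F}]_m | (degq q <= D)%N].
Proof.
apply: (@sub_finite_set _ _ [set` polys_upto D]); first by move=> q; exact: mem_polys_upto.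
exact: finite_seq.
Qed.

End FewPolys.

Section EtaFacts.
Variables (F : finFieldType) (R : realType) (m n : nat).
Variable psi : 'rV[{poly F}]_m -> R.
Local Notation k := (kF F R).
Hypothesis psi_val : forall q, psi q = 0 \/ exists r : int, psi q = k ^ r.
Hypothesis psi_bdd : exists B : R, forall q, psi q <= B.
Hypothesis psi_pos : ~ finite_set [set q | 0 < psi q].
Local Notation term := (eta_term n psi).
Local Notation esumt e :=
  (\esum_(q in [set q : 'rV[{poly F}]_m | q != 0%R]) (term e q)%:E)%E.

Lemma kF_large (x : R) : exists b : nat, x <= k ^+ b.
Proof.
have x1 : 0 < (Num.max x 1)^-1 by rewrite invr_gt0 lt_max ltr01 orbT.
have [b] := kF_small F x1; rewrite lef_pV2 ?posrE ?exprn_gt0 ?kF_gt0 //.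
  by rewrite ge_max => /andP[xb _]; exists b.
by rewrite lt_max ltr01 orbT.
Qed.

Lemma psi_pos_large (P : set 'rV[{poly F}]_m) D : finite_set P ->
  exists q, [/\ ~ P q, 0 < psi q, q != 0 & (D < degq q)%N].
Proof.
move=> finP; apply: contrapT => nq; apply: psi_pos.
apply: (@sub_finite_set _ _ (P `|` ([set 0] `|` [set q | (degq q <= D)%N]))).
  move=> q /= psiq; have [Pq|Pq] := pselect (P q); first by left.
  right; have [->|q0] := eqVneq q 0; [by left|right => /=].
  by rewrite leqNgt; apply/negP => Dq; apply: nq; exists q.
by rewrite !finite_setU; split=> //; split=> //; exact: finite_degq_le.
Qed.

(** Infinitely many [q] have [psi q > 0], and all but finitely many of these have a ratio at most 1,
    hence a term at least 1. So 0 is a lower bound of the set whose infimum is [eta_psi]. *)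
Lemma esumt_npos e : e <= 0 -> ~ (esumt e < +oo)%E.
Proof.
move=> e0 fin; have [B psiB] := psi_bdd; have [b Bb] := kF_large B.
have t0 q : [set q : 'rV[{poly F}]_m | q != 0%R] q -> (0 <= (term e q)%:E)%E.
  by move=> _; rewrite lee_fin eta_term_ge0.
have half0 : 0 < 1 / 2 :> R by rewrite divr_gt0.
have [M tailM] := esum_tail t0 fin half0.
have [q [/= qM psi0 q0 bq]] := psi_pos_large b (@finite_pickle_lt 'rV[{poly F}]_m M).
have := pickled_le_tail t0 (i := pickle q) (M := M).
rewrite leqNgt => /(_ (introN idP qM)) /le_trans /(_ tailM).
rewrite pickledE // lee_fin; apply/negP; rewrite -ltNge.
apply: (@lt_le_trans _ _ 1); first by rewrite ltr_pdivrMr // mul1r ltr1n.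
have q1 := normP_ge1 R q0; have q00 : 0 < normP R q by exact: lt_le_trans ltr01 q1.
rewrite /eta_term mulr_ege1 ?exprn_ege1 //.
have x1 : psi q / normP R q <= 1.
  rewrite ler_pdivrMr // mul1r (le_trans (psiB q)) // (le_trans Bb) // normP_deg //.
  by rewrite ler_eXn2l ?kF_gt1 // ltnW.
have x0 : 0 < psi q / normP R q by rewrite divr_gt0.
rewrite -[e]opprK powRN invf_ge1 ?powR_gt0 //.
apply: (@le_trans _ _ (1 `^ (- e))); last by rewrite powR1.
by rewrite ge0_ler_powR ?nnegrE ?oppr_ge0 ?ler01 // ltW.
Qed.

(** Values of [psi] above 1 are rounded to [r = 0]; the factor [k ^+ b] absorbs the loss. *)
Lemma psi_scale (b : nat) q : (forall q, psi q <= k ^+ b) -> 0 < psi q ->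
  exists r : nat, k ^- r <= psi q <= k ^+ b * k ^- r.
Proof.
move=> psib psi0; have k1 := kF_gt1 F R; have k0 := kF_gt0 F R.
have [psiq|[r psiq]] := psi_val q; first by rewrite psiq ltxx in psi0.
case: r psiq => r psiq.
  by exists 0%N; rewrite expr0 invr1 mulr1 psib andbT psiq -exprnP exprn_ege1 // ltW.
exists r.+1; rewrite psiq NegzE exprnN lexx /=.
by rewrite ler_peMl ?exprz_ge0 ?(ltW k0) // exprn_ege1 // ltW.
Qed.

Lemma geo_sum_le (z : R) M : 0 <= z < 1 -> \sum_(i < M) z ^+ i <= (1 - z)^-1.
Proof.
move=> /andP[z0 z1]; have z1' : 0 < 1 - z by rewrite subr_gt0.
elim: M => [|M IHM]; first by rewrite big_ord0 invr_ge0 ltW.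
rewrite big_ord_recl expr0; under eq_bigr => i _ do rewrite lift0 exprS.
rewrite -mulr_sumr; apply: (@le_trans _ _ (1 + z * (1 - z)^-1)).
  by rewrite lerD2l ler_wpM2l.
by rewrite le_eqVlt; apply/orP; left; apply/eqP; field; rewrite gt_eqF.
Qed.

(** Sorted by degree [d] and level [r], each class of vectors contributes at most
    [C * z ^+ d * z ^+ r] with [z = k^(e' - e) < 1], and the double geometric series converges. The
    contrapositive yields rich scales from divergence. *)
Lemma esumt_fin (K e' e : R) : 0 <= K -> 0 <= e' -> e' < e ->
  (forall (d r : nat) Q, uniq Q -> (forall q, q \in Q ->
      [/\ q != 0, degq q = d & k ^- r <= psi q]) ->
    (size Q)%:R * k ^+ (d * n) <= K * k `^ ((r + d)%:R * e')) ->
  (esumt e < +oo)%E.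
Proof.
move=> K0 e'0 e'e few; have [B psiB] := psi_bdd; have [b Bb] := kF_large B.
have k1 := kF_gt1 F R; have k0 := kF_gt0 F R.
have {Bb}psib q : psi q <= k ^+ b by apply: le_trans Bb.
have e0 : 0 < e by apply: le_lt_trans e'e.
have /choice[rho rhoP] : forall q, exists r : nat, 0 < psi q ->
    k ^- r <= psi q <= k ^+ b * k ^- r.
  move=> q.
  have [psi0|psi0] := ltP 0 (psi q); last by exists 0%N.
  by have [r rP] := psi_scale psib psi0; exists r.
pose z := k `^ (e' - e).
have z01 : 0 <= z < 1.
  rewrite powR_ge0 /= /z -opprB powRN invf_lt1 ?powR_gt0 //.
  by rewrite powR_gt1 // subr_gt0.
pose C := K * k `^ (b%:R * e).
have C0 : 0 <= C by rewrite mulr_ge0 // powR_ge0.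
have termle d r q : q != 0 -> degq q = d -> rho q = r -> 0 < psi q ->
    term e q <= k ^+ (d * n) * k `^ ((b%:R - (r + d)%:R) * e).
  move=> q0 qd qr psi0; rewrite /eta_term normP_deg // qd -exprM.
  apply: ler_wpM2l; first by rewrite exprn_ge0 // ltW.
  rewrite powRrM ge0_ler_powR ?nnegrE ?powR_ge0 ?(ltW e0) ?divr_ge0 ?exprn_ge0 ?(ltW k0) ?(ltW psi0) //.
  have /andP[_ h] := rhoP q psi0; rewrite qr in h.
  rewrite ler_pdivrMr ?exprn_gt0 //; apply: le_trans h _.
  rewrite natrD opprD addrA powRD ?(gt_eqF k0) ?implybT // powRD ?(gt_eqF k0) ?implybT //.
  by rewrite !powRN !powR_mulrn ?(ltW k0) // mulfVK // gt_eqF // exprn_gt0.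
apply: (@le_lt_trans _ _ (C * ((1 - z)^-1 * (1 - z)^-1))%:E); last exact: ltry.
apply: ge_ereal_sup => _ [X [finX XP] <-].
rewrite fsbig_finite // sumEFin lee_fin.
set s := finmap.enum_fset _; pose M := (\max_(q <- s) maxn (degq q) (rho q)).+1.
have us : uniq s by exact: finmap.fset_uniq.
have sP q : q \in s -> q != 0 by rewrite in_fset_set // => /set_mem /XP.
have sM q : q \in s -> (degq q < M)%N /\ (rho q < M)%N.
  move=> qs; rewrite !ltnS.
  have : (maxn (degq q) (rho q) <= \max_(q <- s) maxn (degq q) (rho q))%N.
    exact: leq_bigmax_seq.
  by rewrite geq_max => /andP[].
have inner (d r : nat) :
   \sum_(q <- s | (0 < psi q) && ((degq q == d) && (rho q == r))) term e q <= C * (z ^+ d * z ^+ r).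
  rewrite -big_filter; set Q := seq.filter _ _.
  have QP q : q \in Q -> [/\ q != 0, degq q = d, rho q = r & 0 < psi q].
    by rewrite mem_filter => /andP[/and3P[psi0 /eqP ? /eqP ?] /sP].
  have := few d r Q (filter_uniq _ us) _.
  move=> h; apply: (@le_trans _ _ (\sum_(q <- Q) (k ^+ (d * n) * k `^ ((b%:R - (r + d)%:R) * e)))).
    by rewrite !big_seq; apply: ler_sum => q /QP[? ? ? ?]; exact: termle.
  rewrite big_const_seq count_predT iter_addr_0 -[leLHS]mulr_natl mulrA.
  apply: (@le_trans _ _ (K * k `^ ((r + d)%:R * e') * k `^ ((b%:R - (r + d)%:R) * e))).
    apply: ler_wpM2r; first exact: powR_ge0.
    by apply: h => q /QP[q0 qd qr psi0]; split=> //; have /andP[] := rhoP q psi0; rewrite qr.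
  rewrite /C -!mulrA; apply: ler_wpM2l => //.
  rewrite -exprD -powR_mulrn ?powR_ge0 // -powRrM -!powRD ?(gt_eqF k0) ?implybT //.
  by rewrite le_eqVlt; apply/orP; left; apply/eqP; congr (k `^ _); rewrite !natrD; ring.
have -> : \sum_(q <- s) term e q = \sum_(d < M) \sum_(r < M)
    \sum_(q <- s | (0 < psi q) && ((degq q == d) && (rho q == r))) term e q.
  transitivity (\sum_(q <- s) \sum_(d < M) \sum_(r < M)
      if (0 < psi q) && ((degq q == d) && (rho q == r)) then term e q else 0); last first.
    rewrite exchange_big /=; apply: eq_bigr => d _.
    by rewrite exchange_big /=; apply: eq_bigr => r _; rewrite [RHS]big_mkcond.
  rewrite !big_seq; apply: eq_bigr => q qs.
  have [dM rM] := sM q qs.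
  (* Vectors with [psi q = 0] contribute nothing, as 0 to a positive exponent is 0. *)
  have [psi0|psi0] := ltP 0 (psi q); last first.
    rewrite !big1 => [|d _]; last by rewrite big1.
    rewrite /eta_term; have -> : psi q = 0 by apply/eqP; rewrite eq_le psi0 psi_ge0.
    by rewrite mul0r powR0 ?mulr0 // gt_eqF.
  rewrite (bigD1 (Ordinal dM)) //= (bigD1 (Ordinal rM)) //= !eqxx /=.
  rewrite big1 ?addr0 => [|r rne]; last first.
    by rewrite ifF //; apply/negbTE; apply: contraNN rne => /eqP rr; apply/eqP/val_inj.
  rewrite big1 ?addr0 // => d dne; rewrite big1 // => r _.
  by rewrite ifF //; apply/negbTE; apply: contraNN dne => /andP[/eqP rr _]; apply/eqP/val_inj.
apply: (@le_trans _ _ (\sum_(d < M) \sum_(r < M) C * (z ^+ d * z ^+ r))).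
  by apply: ler_sum => d _; apply: ler_sum => r _; exact: inner.
under eq_bigr => d _ do rewrite -mulr_sumr -mulr_sumr.
rewrite -mulr_sumr -mulr_suml; apply: ler_wpM2l => //.
by apply: ler_pM; rewrite ?geo_sum_le // sumr_ge0 // => i _; rewrite exprn_ge0 //; case/andP: z01.
Qed.

End EtaFacts.

Section Scales.
Variables (F : finFieldType) (R : realType) (m n : nat).
Variable psi : 'rV[{poly F}]_m -> R.
Local Notation k := (kF F R).
Hypothesis psi_val : forall q, psi q = 0 \/ exists r : int, psi q = k ^ r.
Hypothesis psi_bdd : exists B : R, forall q, psi q <= B.
Hypothesis psi_pos : ~ finite_set [set q | 0 < psi q].
Local Notation term := (eta_term n psi).
Local Notation esumt e :=
  (\esum_(q in [set q : 'rV[{poly F}]_m | q != 0%R]) (term e q)%:E)%E.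
Local Notation eta := (@eta_psi F R m n psi).

Lemma few_polys (d r : nat) (Q : seq 'rV[{poly F}]_m) : uniq Q ->
  (forall q, q \in Q -> (degq q <= d)%N) ->
  (size Q)%:R * k ^+ (d * n) <= k ^+ m * k `^ ((r + d)%:R * (m + n)%:R).
Proof.
move=> uQ Qd; have k1 := kF_gt1 F R; have k0 := kF_gt0 F R.
rewrite -natrM powR_mulrn ?(ltW k0) // -exprD.
apply: (@le_trans _ _ (k ^+ (m * d.+1) * k ^+ (d * n))).
  apply: ler_wpM2r; first by rewrite exprn_ge0 // ltW.
  by rewrite -kF_natX ler_nat size_polys_upto.
by rewrite -exprD ler_weXn2l ?(ltW k1) //; nia.
Qed.

(** Counting all vectors of degree [d] suffices at this exponent. The set defining [eta_psi] is
    therefore nonempty, and its [inf] is not a default value. *)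
Lemma esumt_large : (esumt ((m + n)%:R + 1) < +oo)%E.
Proof.
apply: (esumt_fin psi_val psi_bdd (K := k ^+ m) (e' := (m + n)%:R)).
- by rewrite exprn_ge0 // ltW // kF_gt0.
- by rewrite ler0n.
- by rewrite ltrDl.
- by move=> d r Q uQ QP; apply: few_polys => // q /QP[_ -> _].
Qed.

Lemma eta_lt e : eta < e -> exists e0, [/\ 0 < e0, e0 < e & (esumt e0 < +oo)%E].
Proof.
move=> /inf_lt => /(_ _)[|e0 fin e0e]; first by exists ((m + n)%:R + 1); exact: esumt_large.
exists e0; split=> //; rewrite ltNge; apply/negP => e00.
exact: (esumt_npos psi_bdd psi_pos e00 fin).
Qed.

Lemma lt_eta e : e < eta -> ~ (esumt e < +oo)%E.
Proof.
move=> ee fin; move: ee; apply/negP; rewrite -leNgt; apply: ge_inf => //.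
exists 0 => e0 fin0; rewrite leNgt; apply/negP => /ltW e00.
exact: (esumt_npos psi_bdd psi_pos e00 fin0).
Qed.

Lemma eta_ge0 : 0 <= eta.
Proof.
rewrite leNgt; apply/negP => /eta_lt[e0 [e00 e0l _]].
by move: (lt_trans e00 e0l); rewrite ltxx.
Qed.

(** If no scale of degree at least [D] were this rich, [esumt_fin] would give convergence at the
    midpoint of [e] and [eta], below [eta]. For [e = 0] a single vector is enough. *)
Lemma good_scales e : e = 0 \/ 0 < e < eta -> forall D, exists d r Q,
  [/\ (D <= d)%N, uniq Q, (0 < size Q)%N,
      forall q, q \in Q -> [/\ q != 0, degq q = d & k ^- r <= psi q] &
      k `^ ((r + d)%:R * e) <= (size Q)%:R * k ^+ (d * n)].
Proof.
have k1 := kF_gt1 F R; have k0 := kF_gt0 F R.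
have [B psiB] := psi_bdd; have [b Bb] := kF_large F B.
have psib q : psi q <= k ^+ b by apply: le_trans Bb.
case=> [->|/andP[e0 ee]] D.
  have [q [_ psi0 q0 qD]] := psi_pos_large psi_pos D (finite_set0 _).
  have [r /andP[rq _]] := psi_scale psi_val psib psi0.
  exists (degq q), r, [:: q]; split=> //; first exact: ltnW.
    by move=> q'; rewrite inE => /eqP ->.
  by rewrite mulr0 powRr0 mul1r exprn_ege1 // ltW.
apply: contrapT => nogood.
have emid : e < (e + eta) / 2 < eta.
  by apply/andP; split; [rewrite ltr_pdivlMr // mulr_natr mulr2n ltrD2l
                       |rewrite ltr_pdivrMr // mulr_natr mulr2n ltrD2r].
case/andP: emid => emid /lt_eta; apply.
(* The second summand pays for the degrees below [D], where all vectors are counted; the 1 pays for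
   the others. *)
pose K := 1 + k ^+ m * k ^+ (D * n + m * D).
have KD0 : 0 <= k ^+ m * k ^+ (D * n + m * D).
  by rewrite mulr_ge0 // exprn_ge0 // ltW.
have K0 : 0 <= K by exact: addr_ge0.
apply: (esumt_fin psi_val psi_bdd K0 (ltW e0) emid).
move=> d r Q uQ QP.
have pge : 1 <= k `^ ((r + d)%:R * e).
  apply: (@le_trans _ _ (k `^ 0)); first by rewrite powRr0.
  by apply: (ler_powR (ltW k1)); rewrite mulr_ge0 ?ler0n // ltW.
have pge0 := le_trans ler01 pge.
have [dD|Dd] := ltnP d D.
  apply: (@le_trans _ _ K); last by rewrite ler_peMr.
  apply: (@le_trans _ _ (k ^+ m * k ^+ (D * n + m * D))); last by rewrite lerDr.
  apply: (@le_trans _ _ (k ^+ (m * d.+1) * k ^+ (d * n))).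
    apply: ler_wpM2r; first by rewrite exprn_ge0 // ltW.
    by rewrite -kF_natX ler_nat size_polys_upto // => q /QP[_ -> _].
  by rewrite -!exprD ler_weXn2l ?(ltW k1) //; nia.
apply: (@le_trans _ _ (1 * k `^ ((r + d)%:R * e))); last first.
  by apply: ler_wpM2r => //; rewrite lerDl.
rewrite mul1r leNgt; apply/negP => big; apply: nogood.
exists d, r, Q; split=> //; last exact: ltW.
rewrite lt0n; apply: contraTneq big => ->.
by rewrite mul0r -leNgt.
Qed.

End Scales.

(** * Digits and the tree of matrices *)

Section TreeDimension.
Variables (F : finFieldType) (R : realType) (m n : nat).
Local Notation k := (kF F R).
Local Notation V := 'M[F]_(m, n).
Implicit Type x : nat -> V.

Definition digit_coef x (i : 'I_m) (j : 'I_n) (t : int) : F :=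
  match t with Posz _ => 0 | Negz e => x e i j end.

Lemma digit_laurent x i j : is_laurent (digit_coef x i j).
Proof. by exists 0 => -[]. Qed.

Definition of_digits x : 'I_m -> 'I_n -> laurent F :=
  fun i j => exist _ (digit_coef x i j) (digit_laurent x i j).

Lemma distM_of_digits x y (l : nat) : distM R (of_digits x) (of_digits y) < k ^- l ->
  mkseq x l = mkseq y l.
Proof.
rewrite exprnN => xy; apply: (@eq_from_nth _ 0); rewrite ?size_mkseq // => e el.
rewrite !nth_mkseq //; apply/matrixP => i j.
by apply: (distM_lt xy i j (t := Negz e)); rewrite NegzE lerN2 lez_nat.
Qed.

(** A set of small diameter fixes the leading digits of its matrices, so a cheap cover becomes a
    cheap list of words. The path given by [energy_avoid] is then a matrix of [E] in no [U i]. *)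
Lemma not_coverable_tree (E : set ('I_m -> 'I_n -> laurent F)) (mu : seq V -> R) (s s' C : R) :
  (forall v, 0 <= mu v) -> (forall v, mu v = \sum_a mu (rcons v a)) ->
  mu [::] = 1 -> 0 <= s' -> s' < s -> 0 < C ->
  (forall L, \sum_(l < L) \sum_(v <- words V l) mu v ^+ 2 / (k ^- l) `^ s <= C) ->
  (forall x, (forall l, 0 < mu (mkseq x l)) -> E (of_digits x)) ->
  exists delta eps, [/\ 0 < delta, 0 < eps & ~ coverable (@distM F R m n) delta s' E eps%:E].
Proof.
move=> mu0 musplit munil s'0 s's C0 energy muE.
have k1 := kF_gt1 F R; have k0 := kF_gt0 F R.
have s0 : 0 < s by apply: le_lt_trans s's.
(* Half of the budget [(16 * C)^-1] of [energy_avoid]: one half is for the cost of the cover, the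
   other for the errors [c / 2^(i+1)]. *)
pose c := (32 * C)^-1; have c0 : 0 < c by rewrite invr_gt0 mulr_gt0.
have ks' : 0 < k `^ s' by exact: powR_gt0.
exists k^-1, (c / k `^ s'); split; rewrite ?invr_gt0 ?divr_gt0 //.
move=> [U [EU Ud Us]].
pose om l := (k ^- l) `^ s.
have kl0 (l : nat) : 0 < k ^- l by rewrite invr_gt0 exprn_gt0.
have om0 l : 0 < om l by exact: powR_gt0.
pose h i := fine (hterm (@distM F R m n) s' (U i)).
have hE i : hterm (@distM F R m n) s' (U i) = (h i)%:E.
  by rewrite /h /hterm; case: ifP.
have hge0 i : 0 <= h i by rewrite -lee_fin -hE hterm_ge0.
have omsmall (y : R) : 0 < y -> exists l, om l <= y.
  move=> y0; have [z [z0 zP]] := kF_powR_small ltr01 s0 y0.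
  have [l lz] := kF_small F z0; exists l.
  by rewrite -[om l]mul1r; apply: zP => //; exact: ltW.
have /choice[b bP] : forall i, exists b : seq V,
    (forall x, U i (of_digits x) -> mkseq x (size b) = b) /\
    om (size b) <= k `^ s' * h i + c / (2 ^ i.+1)%:R.
  move=> i; pose ci := c / (2 ^ i.+1)%:R.
  have ci0 : 0 < ci by rewrite divr_gt0 // ltr0n expn_gt0.
  have [l1 l1P] := omsmall ci ci0.
  have [[x0 Ux0]|nx] := pselect (exists x, U i (of_digits x)); last first.
    exists (nseq l1 0); split; first by move=> x Ux; case: nx; exists x.
    by rewrite size_nseq ler_wpDl // mulr_ge0 // ltW.
  have hi : h i = fine (diamE (@distM F R m n) (U i)) `^ s'.
    by rewrite /h /hterm asboolF // => U0; rewrite U0 in Ux0.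
  set D := fine _ in hi.
  have dfin : diamE (@distM F R m n) (U i) \is a fin_num.
    have lo := le_diamE (@distM F R m n) Ux0 Ux0; have := Ud i.
    by rewrite fin_numE; move: lo; case: (diamE _ _).
  have DU x : U i (of_digits x) -> distM R (of_digits x) (of_digits x0) <= D.
    by move=> Ux; rewrite -lee_fin /D fineK //; exact: le_diamE.
  have D0 : 0 <= D by apply: le_trans (DU _ Ux0); exact: distM_ge0.
  have Dk : D <= k^-1 by rewrite -lee_fin /D fineK.
  have cut l : D < k ^- l -> om l <= k `^ s' * h i + ci ->
      exists b : seq V, (forall x, U i (of_digits x) -> mkseq x (size b) = b) /\
        om (size b) <= k `^ s' * h i + ci.
    move=> Dl oml; exists (mkseq x0 l); rewrite size_mkseq; split=> // x Ux.
    by apply: distM_of_digits; apply: le_lt_trans Dl; exact: DU.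
  (* A diameter below [k^-l1], possibly 0, is paid for by the error term. *)
  have [Dl1|l1D] := ltP D (k ^- l1).
    by apply: (cut l1) => //; rewrite ler_wpDl // mulr_ge0 // ltW.
  have ex : exists l, k ^- l <= D by exists l1.
  (* The least exponent with [k^-(l+1) <= D]; it is not 0 because the covering sets have diameter at
     most [k^-1]. Then [D < k^-l <= k * D], whence the factor [k^s']. *)
  case: (ex_minnP ex) => -[|l] lD lmin.
    by move: (le_trans lD Dk); rewrite expr0 invr1 leNgt invf_lt1 // k1.
  have Dl : D < k ^- l.
    by rewrite ltNge; apply/negP => /lmin; rewrite ltnn.
  apply: (cut l) => //; apply: ler_wpDr; first exact: ltW.
  rewrite hi -powRM ?(ltW k0) //; apply: (@le_trans _ _ ((k ^- l) `^ s')).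
    have kl1 : 0 < k ^- l <= 1 by rewrite kl0 /= invf_le1 ?exprn_gt0 // exprn_ege1 // ltW.
    by apply: (ger_powR kl1); exact: ltW.

  rewrite ge0_ler_powR ?nnegrE ?mulr_ge0 ?(ltW k0) //; first exact: ltW.
  by rewrite -ler_pdivrMl // mulrC -invfM -exprSr.
have [|x xP] := energy_avoid mu0 musplit munil om0 (b := b) C0 energy.
  move=> M; apply: (@le_trans _ _ (\sum_(i < M) (k `^ s' * h i + c / (2 ^ i.+1)%:R))).
    by apply: ler_sum => i _; have [] := bP i.
  rewrite big_split /=.
  have -> : (16 * C)^-1 = c + c by rewrite /c; field; rewrite gt_eqF.
  apply: lerD.
    rewrite -mulr_sumr -ler_pdivlMl // mulrC -lee_fin; apply: le_trans Us.
    apply: le_trans (nneseries_lim_ge M _); last by move=> *; exact: hterm_ge0.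
    by rewrite big_mkord -sumEFin le_eqVlt; apply/orP; left; apply/eqP; apply: eq_bigr => i _; rewrite hE.
  rewrite -lee_fin -sumEFin; apply: le_trans (epsilon_trick0 xpredT (ltW c0)).
  apply: le_trans (nneseries_lim_ge M _); first by rewrite big_mkord.
  by move=> i _ _; rewrite lee_fin divr_ge0 // ltW.
have /EU[i _ Ui] : E (of_digits x) by apply: muE => l; have [] := xP l.
have [bx _] := bP i; have [_ /(_ i)] := xP (size (b i)); apply; exact: bx.
Qed.

End TreeDimension.

(** * The density of a union of strips *)

Local Close Scope classical_set_scope.

Section Density.
Variables (F : finFieldType) (R : realType) (m n : nat).
Local Notation k := (kF F R).
Local Notation V := 'M[F]_(m, n).
Implicit Types (q : 'rV[{poly F}]_m) (v : seq V) (Q : seq 'rV[{poly F}]_m).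

Lemma rVpoly_row_inj (t : nat) (c c' : 'M[F]_(n, t)) :
  (forall j, rVpoly (row j c) = rVpoly (row j c')) -> c = c'.
Proof.
by move=> cc'; apply/row_matrixP => j; apply: (can_inj rVpolyK); exact: cc'.
Qed.

(** For [c = 0] only [c' = 0] remains, once for each [q']. For [c != 0] choose [j0] with
    [c_j0 != 0]: the entry [c'_j0] divides the nonzero [c_j0 q_i0], and it determines first [q'] and
    then [c'], so each [c] admits at most [Dv] pairs. *)
Lemma sum_card_relations (l t d Dv : nat) q Q :
  (d + t <= l)%N -> q != 0 -> degq q = d -> uniq Q ->
  (forall q', q' \in Q -> q' != 0 /\ degq q' = d) ->
  (forall f : {poly F}, f != 0 -> (size f <= d + t)%N ->
     forall s, uniq s -> all (fun h => h %| f) s -> (size s <= Dv)%N) ->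
  (\sum_(q' <- Q) #|@relations F m n l t q q'| <= size Q + #|F| ^ (t * n) * Dv)%N.
Proof.
move=> dtl q0 qd uQ QP div.
have [i0 qi0] := degq_attained q0; rewrite qd in qi0.
have qi00 : q ord0 i0 != 0 by rewrite -size_poly_gt0 qi0.
have szl q1 : degq q1 = d -> forall i, (size (q1 ord0 i) + t <= l.+1)%N.
  move=> q1d i; apply: (@leq_trans (d.+1 + t)); last by rewrite addSn ltnS.
  by rewrite leq_add2r -q1d size_degq.
pose P q' (c c' : 'M[F]_(n, t)) := [forall i, [forall j,
  rVpoly (row j c) * q ord0 i + rVpoly (row j c') * q' ord0 i == 0]].
apply: (@leq_trans (\sum_(q' <- Q) \sum_(c : 'M[F]_(n, t)) \sum_(c' : 'M[F]_(n, t)) P q' c c')%N).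
  rewrite !big_seq; apply: leq_sum => q' /QP[q'0 q'd].
  rewrite pair_big /= -card_set_sum; apply: subset_leq_card; apply/fintype.subsetP => w wr.
  rewrite inE; apply/forallP => i; apply/forallP => j; apply/eqP.
  by apply: (relationsP wr); exact: szl.
rewrite exchange_big (bigD1 0) //=; apply: leq_add.
  rewrite -[size Q]muln1 -sum1_size big_distrl /= !big_seq; apply: leq_sum => q' q'Q.
  have [q'0 q'd] := QP _ q'Q; have [i' q'i'] := degq_attained q'0.
  have q'i'0 : q' ord0 i' != 0 by rewrite -size_poly_gt0 q'i'.
  rewrite (bigD1 0) //= big1 ?addn0 ?mul1n ?leq_b1 // => c' c'0.
  apply/eqP; rewrite eqb0; apply: contra c'0 => /forallP/(_ i')/forallP Pc'.
  apply/eqP/rVpoly_row_inj => j; apply/eqP; have := Pc' j.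
  by rewrite !row0 linear0 mul0r add0r mulf_eq0 (negbTE q'i'0) orbF.
have -> : (#|F| ^ (t * n) * Dv = \sum_(c : 'M[F]_(n, t)) Dv)%N.
  by rewrite sum_nat_const card_mx (mulnC n).
rewrite [leqRHS](bigD1 0) //=; apply: leq_trans (leq_addl _ _).
apply: leq_sum => c c0.
have [j0 cj0] : exists j, rVpoly (row j c) != 0.
  apply/existsP; apply: contraNT c0; rewrite negb_exists => /forallP cj.
  apply/eqP/rVpoly_row_inj => j; rewrite row0 linear0; apply/eqP.
  by rewrite -[_ == _]negbK cj.
set f := rVpoly (row j0 c) * q ord0 i0.
have f0 : f != 0 by rewrite mulf_neq0.
have fs : (size f <= d + t)%N.
  apply: leq_trans (size_polyMleq _ _) _; rewrite qi0 addnS /= addnC leq_add2l.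
  exact: size_poly.
pose s := [seq x <- [seq (q', c') | q' <- Q, c' <- enum 'M[F]_(n, t)] | P x.1 c x.2].
have sP x : x \in s -> x.1 \in Q /\ P x.1 c x.2.
  by rewrite mem_filter => /andP[Px /allpairsP[[q' c'] /= [q'Q _ xE]]]; split=> //; rewrite xE.
have -> : (\sum_(q' <- Q) \sum_(c' : 'M[F]_(n, t)) P q' c c' = size s)%N.
  rewrite size_filter -sumn_count sumnE big_map big_allpairs_dep /=.
  by apply: eq_bigr => q' _; rewrite big_enum.
rewrite -(size_map (fun x => rVpoly (row j0 x.2))); apply: (div f f0 fs).
  rewrite map_inj_in_uniq.
    by rewrite filter_uniq // allpairs_uniq ?enum_uniq // => -[? ?] [? ?].
  move=> [q1 c1] [q2 c2] /sP[/= q1Q P1] /sP[/= q2Q P2] c12.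
  have rel (q' : 'rV[{poly F}]_m) (c' : 'M[F]_(n, t)) : P q' c c' ->
      forall i j, rVpoly (row j c') * q' ord0 i = - (rVpoly (row j c) * q ord0 i).
    by move=> /forallP h i j; apply/eqP; rewrite -addr_eq0 addrC; move/forallP: (h i).
  have c1j0 : rVpoly (row j0 c1) != 0.
    apply: contraNneq f0 => c1j0; have := rel _ _ P1 i0 j0.
    by rewrite c1j0 mul0r => /eqP; rewrite eq_sym oppr_eq0.
  have q12 : q1 = q2.
    apply/rowP => i; apply: (mulfI c1j0); rewrite (rel _ _ P1) {1}c12 (rel _ _ P2) //.
  subst q2; congr (_, _); apply: rVpoly_row_inj => j.
  have [q10 _] := QP _ q1Q; have [i1 q1i1] := degq_attained q10.
  have q1i10 : q1 ord0 i1 != 0 by rewrite -size_poly_gt0 q1i1.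
  by apply: (mulIf q1i10); rewrite (rel _ _ P1) (rel _ _ P2).
apply/allP => h /mapP[[q' c'] /sP[/= _ /forallP/(_ i0)/forallP/(_ j0) rel0] -> /=].
by move: rel0; rewrite addr_eq0 -/f => /eqP ->; rewrite dvdpNr dvdp_mulr.
Qed.

(* When [|q| = k^d], this is the conditional expectation, given the digits [v], of the
   indicator of [||qA|| < k^-r] divided by its mean: the digits [v] determine
   [minn (size v - d) r] digits of [qA]. *)
Definition strip_density (d r : nat) q v : R :=
  let t := minn (size v - d) r in k ^+ (t * n) * (wstrip q t v)%:R.

Definition density (d r : nat) Q v : R :=
  (size Q)%:R^-1 * \sum_(q <- Q) strip_density d r q v.

Lemma strip_density_ge0 d r q v : 0 <= strip_density d r q v.
Proof. by rewrite mulr_ge0 ?ler0n // exprn_ge0 // ltW // kF_gt0. Qed.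

Lemma density_ge0 d r Q v : 0 <= density d r Q v.
Proof.
by rewrite mulr_ge0 ?invr_ge0 ?ler0n // sumr_ge0 // => q _; exact: strip_density_ge0.
Qed.

Lemma density_le d r Q v : (0 < size Q)%N -> density d r Q v <= k ^+ (r * n).
Proof.
move=> Q0; rewrite ler_pdivrMl ?ltr0n // -sum1_size natr_sum mulr_suml.
apply: ler_sum => q _; rewrite mul1r /strip_density.
apply: (@le_trans _ _ (k ^+ (minn (size v - d) r * n))).
  by rewrite ler_piMr ?exprn_ge0 ?(ltW (kF_gt0 F R)) //; case: wstrip.
by rewrite ler_weXn2l ?(ltW (kF_gt1 F R)) // leq_mul2r geq_minr orbT.
Qed.

Lemma density_early d r Q v : (0 < size Q)%N -> (size v <= d)%N -> density d r Q v = 1.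
Proof.
move=> Q0 vd; rewrite /density.
rewrite (eq_bigr (fun=> 1)) => [|q _]; last first.
  rewrite /strip_density (eqP vd) min0n mul0n expr0 mul1r.
  by rewrite (_ : wstrip q 0 v) //; apply/forallP => j; apply/forallP => -[].
by rewrite big_const_seq count_predT iter_addr_0 mulVf // pnatr_eq0 -lt0n.
Qed.

Lemma density_gt0 d r Q v : (d + r <= size v)%N -> 0 < density d r Q v ->
  exists2 q, q \in Q & wstrip q r v.
Proof.
move=> drv; apply: contraPP => none; rewrite /density big_seq big1 ?mulr0 ?ltxx // => q qQ.
rewrite /strip_density (minn_idPr _); last by rewrite leq_subRL // (leq_trans _ drv) // leq_addr.
case: (boolP (wstrip q r v)) => [qv|]; last by rewrite mulr0.
by case: none; exists q.
Qed.

(** Expanding the square gives correlations of two strips, which [card_two_strips] turns into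
    numbers of relations; the normalising factor [k^(2tn)] cancels. *)
Lemma second_moment (d r l Dv : nat) Q : (d <= l)%N -> (0 < size Q)%N -> uniq Q ->
  (forall q, q \in Q -> q != 0 /\ degq q = d) ->
  let t := minn (l - d) r in
  (forall f : {poly F}, f != 0 -> (size f <= d + t)%N ->
     forall s, uniq s -> all (fun h => h %| f) s -> (size s <= Dv)%N) ->
  \sum_(v <- words V l) density d r Q v ^+ 2 <=
    k ^+ (l * m * n) * (1 + k ^+ (t * n) * Dv%:R / (size Q)%:R).
Proof.
move=> dl Q0 uQ QP t div; set N : R := (size Q)%:R.
have N0 : 0 < N by rewrite ltr0n.
have k0 := kF_gt0 F R.
have dtl : (d + t <= l)%N by rewrite /t; lia.
have -> : \sum_(v <- words V l) density d r Q v ^+ 2 =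
    N ^- 2 * \sum_(q <- Q) \sum_(q' <- Q) (#|@relations F m n l t q q'|)%:R * k ^+ (l * m * n).
  rewrite (eq_big_seq (fun v => N ^- 2 * \sum_(q <- Q) \sum_(q' <- Q)
      k ^+ (2 * t * n) * (wstrip q t v && wstrip q' t v)%:R)); last first.
    move=> v; rewrite mem_words => /eqP vl.
    rewrite /density exprMn exprVn; congr (_ * _); rewrite expr2 big_distrlr /=.
    apply: eq_bigr => q _; apply: eq_bigr => q' _; rewrite /strip_density vl -/t.
    by rewrite mulrACA -exprD -natrM mulnb -mulnDl addnn -mul2n.
  rewrite -mulr_sumr exchange_big; congr (_ * _); apply: eq_bigr => q _ /=.
  rewrite exchange_big; apply: eq_bigr => q' _ /=.
  rewrite -mulr_sumr big_words_ffun -natr_sum -card_set_sum.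
  by rewrite -!(kF_natX F R) -!natrM mulnC card_two_strips.
under eq_bigr => q _ do rewrite -mulr_suml -natr_sum.
apply: (@le_trans _ _ (N ^- 2 * \sum_(q <- Q) (N + k ^+ (t * n) * Dv%:R) * k ^+ (l * m * n))).
  rewrite ler_wpM2l ?invr_ge0 ?exprn_ge0 ?(ltW N0) // !big_seq; apply: ler_sum => q qQ.
  rewrite ler_wpM2r ?exprn_ge0 ?(ltW k0) //; have [q0 qd] := QP _ qQ.
  rewrite -(kF_natX F R) -natrM -natrD ler_nat.
  exact: (sum_card_relations dtl q0 qd uQ QP div).
rewrite big_const_seq count_predT iter_addr_0 -[X in _ * X <= _]mulr_natl -/N.
by rewrite le_eqVlt; apply/orP; left; apply/eqP; field; rewrite gt_eqF.
Qed.

End Density.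

(** * Martingale property of the densities *)

Section Martingale.
Variables (F : finFieldType) (R : realType) (m n : nat).
Local Notation k := (kF F R).
Local Notation V := 'M[F]_(m, n).
Implicit Types (q : 'rV[{poly F}]_m) (v : seq V) (Q : seq 'rV[{poly F}]_m).

Lemma wcoef_rcons_early q v (a : V) j s : (degq q + s < size v)%N ->
  wcoef q (rcons v a) j s = wcoef q v j s.
Proof.
move=> qs; apply: eq_bigr => i _; apply: eq_bigr => e _; rewrite nth_rcons ifT //.
apply: leq_ltn_trans qs; rewrite addnC leq_add2r -ltnS.
exact: leq_trans (ltn_ord e) (size_degq q i).
Qed.

Lemma wcoef_rcons q v (a : V) j s : size v = (degq q + s)%N ->
  wcoef q (rcons v a) j s = wcoef q v j s + \sum_i (q ord0 i)`_(degq q) * a i j.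
Proof.
move=> vs; rewrite -big_split; apply: eq_bigr => i _ /=.
rewrite -!(big_mkord xpredT (fun e => (q ord0 i)`_e * nth 0 (_ : seq V) (s + e)%N i j)).
have widen (w : seq V) : \sum_(0 <= e < size (q ord0 i)) (q ord0 i)`_e * nth 0 w (s + e)%N i j =
    \sum_(0 <= e < (degq q).+1) (q ord0 i)`_e * nth 0 w (s + e)%N i j.
  rewrite (big_cat_nat (n := size (q ord0 i)) _ (size_degq q i)) //= [X in _ = _ + X]big1_seq ?addr0 //.
  by move=> e /andP[_]; rewrite mem_index_iota => /andP[qe _]; rewrite nth_default ?mul0r.
have v0 : nth 0 v (s + degq q)%N i j = 0 by rewrite nth_default ?mxE // vs addnC.
rewrite !widen !big_nat_recr //= v0 mulr0 addr0 nth_rcons vs addnC eqxx ltnn; congr (_ + _).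
by apply: eq_big_nat => e /andP[_ ed]; rewrite nth_rcons vs addnC ltn_add2r ed.
Qed.

(** Some entry of [q] has a nonzero coefficient of degree [degq q], so changing row [i0] of the new
    digit shifts the [n] new coefficients arbitrarily; they vanish for exactly the proportion [k^-n]
    of digits. *)
Lemma card_extend q v s : q != 0 -> size v = (degq q + s)%N ->
  (#|[set a : V | [forall j, wcoef q (rcons v a) j s == 0%R]]| * #|F| ^ n = #|F| ^ (m * n))%N.
Proof.
move=> q0 vs; have [i0 qi0] := degq_attained q0.
have lam0 : (q ord0 i0)`_(degq q) != 0.
  by rewrite -[degq q]/((degq q).+1.-1) -qi0 -lead_coefE lead_coef_eq0 -size_poly_gt0 qi0.
pose phi (a : V) : 'rV[F]_n := \row_j wcoef q (rcons v a) j s.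
pose sigma (y : 'rV[F]_n) (a : V) : V :=
  (\matrix_(i, j) if i == i0 then y 0 j / (q ord0 i0)`_(degq q) else 0) + a.
have := @card_fiber _ _ phi sigma _ _ 0.
rewrite !card_mx mul1n => <-; last 2 first.
- by move=> y; exact: addrI.
- move=> y a; apply/rowP => j; rewrite !mxE !(wcoef_rcons _ _ vs) -addrA; congr (_ + _).
  rewrite (bigD1 i0) //= (eq_bigr (fun i => (q ord0 i)`_(degq q) * a i j)); last first.
    by move=> i /negbTE ii0; rewrite !mxE ii0 add0r.
  rewrite [in RHS](bigD1 i0) //= !mxE eqxx mulrDr mulrCA divff // mulr1.
  by rewrite -addrA addrC.
congr (_ * _)%N; apply: eq_card => a; rewrite !inE; apply/forallP/eqP.
  by move=> h; apply/rowP => j; rewrite !mxE; exact/eqP.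
by move=> /rowP h j; have := h j; rewrite !mxE => ->.
Qed.

Lemma wstripS q v (a : V) t : size v = (degq q + t)%N ->
  wstrip q t.+1 (rcons v a) = wstrip q t v && [forall j, wcoef q (rcons v a) j t == 0].
Proof.
move=> vt; apply/forallP/andP => [h|[/forallP h1 /forallP h2] j].
  split; apply/forallP => j; last exact: (forallP (h j) ord_max).
  apply/forallP => s; rewrite -(@wcoef_rcons_early q v a) ?vt ?ltn_add2l //.
  exact: (forallP (h j) (widen_ord (leqnSn t) s)).
apply/forallP => s; have [st|ts] := ltnP s t.
  rewrite wcoef_rcons_early ?vt ?ltn_add2l //.
  exact: (forallP (h1 j) (Ordinal st)).
have -> : (s : nat) = t by apply/eqP; rewrite eqn_leq ts -ltnS ltn_ord.
exact: h2.
Qed.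

Lemma wstrip_rcons q v (a : V) t : (degq q + t <= size v)%N ->
  wstrip q t (rcons v a) = wstrip q t v.
Proof.
move=> vt; apply: eq_forallb => j; apply: eq_forallb => s.
by rewrite wcoef_rcons_early // (leq_trans _ vt) // ltn_add2l.
Qed.

Lemma wstrip0 q v : wstrip q 0 v.
Proof. by apply/forallP => j; apply/forallP => -[]. Qed.

(** Before depth [d] the density is 1, and from [d + r] on it is frozen. In between, a new digit
    multiplies it by [k^n] with proportion [k^-n] and kills it otherwise. *)
Lemma strip_density_split r q v : q != 0 ->
  \sum_(a : V) strip_density R (degq q) r q (rcons v a) =
    k ^+ (m * n) * strip_density R (degq q) r q v.
Proof.
move=> q0; set d := degq q; rewrite /strip_density.
have k0 := kF_gt0 F R.
have const (t : nat) : (d + t <= size v)%N ->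
  \sum_(a : V) k ^+ (t * n) * (wstrip q t (rcons v a))%:R =
    k ^+ (m * n) * (k ^+ (t * n) * (wstrip q t v)%:R).
  move=> tv; under eq_bigr => a _ do rewrite wstrip_rcons //.
  by rewrite sumr_const card_mx -[LHS]mulr_natl kF_natX.
have [dr|dr] := leqP (d + r) (size v).
  rewrite -const; last by rewrite (leq_trans _ dr) // leq_add2l geq_minr.
  have -> : minn (size v - d) r = r by apply/minn_idPr; rewrite leq_subRL // (leq_trans _ dr) // leq_addr.
  apply: eq_bigr => a _; rewrite size_rcons.
  by have -> : minn ((size v).+1 - d) r = r by apply/minn_idPr; lia.
have [vd|dv] := ltnP (size v) d.
  have -> : minn (size v - d) r = 0%N by lia.
  have m0 : minn ((size v).+1 - d) r = 0%N by rewrite (eqP vd) min0n.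
  rewrite (eq_bigr (fun=> k ^+ (0 * n) * true%:R)) => [|a _]; last by rewrite size_rcons m0 wstrip0.
  by rewrite wstrip0 sumr_const card_mx -[LHS]mulr_natl kF_natX.
set t := (size v - d)%N; have vt : size v = (d + t)%N by rewrite subnKC.
have -> : minn t r = t by lia.
under eq_bigr => a _.
  rewrite size_rcons (_ : minn ((size v).+1 - d) r = t.+1); last by lia.
  rewrite wstripS // -mulnb natrM mulrCA; over.
rewrite -mulr_sumr -mulr_sumr -natr_sum -card_set_sum.
have := card_extend q0 vt => /(congr1 (fun x : nat => x%:R : R)).
rewrite natrM !kF_natX => <-.
by rewrite mulSn exprD; ring.
Qed.

Lemma density_split d r Q v : (forall q, q \in Q -> q != 0 /\ degq q = d) ->
  \sum_(a : V) density R d r Q (rcons v a) = k ^+ (m * n) * density R d r Q v.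
Proof.
move=> QP; rewrite /density -mulr_sumr exchange_big [RHS]mulrCA; congr (_ * _).
by rewrite mulr_sumr !big_seq; apply: eq_bigr => q /QP[q0 <-]; exact: strip_density_split.
Qed.

End Martingale.

(** * The limiting mass distribution *)

Local Open Scope classical_set_scope.
Local Open Scope ring_scope.

Section Product.
Variables (F : finFieldType) (R : realType) (m n : nat).
Variable psi : 'rV[{poly F}]_m -> R.
Local Notation k := (kF F R).
Local Notation V := 'M[F]_(m, n).
Variables (d r : nat -> nat) (Q : nat -> seq 'rV[{poly F}]_m).
Hypothesis d_lt : forall J, (d J + r J < d J.+1)%N.
Hypothesis Q_gt0 : forall J, (0 < size (Q J))%N.
Hypothesis QP : forall J q, q \in Q J -> [/\ q != 0, degq q = d J & k ^- r J <= psi q].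
Local Notation g J := (density R (d J) (r J) (Q J)).

Let k0 : 0 < k := kF_gt0 F R.
Let k1 : 1 < k := kF_gt1 F R.

Lemma stage_lt I J : (I < J)%N -> (d I + r I < d J)%N.
Proof.
elim: J => // J IHJ; rewrite ltnS leq_eqVlt => /orP[/eqP ->|/IHJ IJ]; first exact: d_lt.
by apply: ltn_trans IJ _; apply: leq_ltn_trans (d_lt J); exact: leq_addr.
Qed.

Lemma stage_ge J : (J <= d J)%N.
Proof.
elim: J => // J IHJ; apply: leq_ltn_trans IHJ _.
by apply: leq_ltn_trans (d_lt J); exact: leq_addr.
Qed.

Definition stage_prod (M : nat) (v : seq V) : R := \prod_(J < M) g J v.

(** Since [J <= d J], the factors with [J >= size v] equal 1 at [v], so the product up to [size v]
    is in effect the infinite one. *)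
Definition tree_mass (v : seq V) : R := stage_prod (size v) v / k ^+ (m * n * size v).

Lemma stage_prod_ge0 M v : 0 <= stage_prod M v.
Proof. by apply: prodr_ge0 => J _; exact: density_ge0. Qed.

Lemma stage_prod_early M M' v : (M' <= M)%N -> (size v <= d M')%N ->
  stage_prod M v = stage_prod M' v.
Proof.
move=> /subnKC <-; move: (M - M')%N => c vM'.
elim: c => [|c IHc]; first by rewrite addn0.
rewrite addnS /stage_prod big_ord_recr /= -/(stage_prod _ v) IHc density_early ?mulr1 //.
apply: leq_trans vM' _; case: c {IHc} => [|c]; first by rewrite addn0.
by apply: ltnW; apply: leq_ltn_trans (stage_lt (_ : M' < M' + c.+1)%N); rewrite ?leq_addr // addnS ltnS leq_addr.
Qed.

Lemma stage_prod_size M v : (size v <= M)%N -> stage_prod M v = stage_prod (size v) v.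
Proof. by move=> vM; apply: stage_prod_early => //; exact: stage_ge. Qed.

(** The stages occupy disjoint ranges of depth, so at most one factor changes when a digit is
    appended, and that one is a martingale. *)
Lemma stage_prod_split v : \sum_(a : V) stage_prod (size v).+1 (rcons v a) =
  k ^+ (m * n) * stage_prod (size v).+1 v.
Proof.
have late J a : (d J + r J <= size v)%N || (size v < d J)%N -> g J (rcons v a) = g J v.
  move=> /orP[vJ|vJ]; last by rewrite !density_early // ?size_rcons // ltnW.
  rewrite /density; congr (_ * _); rewrite !big_seq; apply: eq_bigr => q /QP[_ qd _].
  rewrite /strip_density size_rcons.
  have -> : minn ((size v).+1 - d J) (r J) = r J by apply/minn_idPr; lia.
  have -> : minn (size v - d J) (r J) = r J by apply/minn_idPr; lia.
  by rewrite wstrip_rcons // qd.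
have [[J0 /andP[dJ0 vJ0]]|none] := pselect (exists J, (d J <= size v < d J + r J)%N); last first.
  under eq_bigr => a _.
    rewrite /stage_prod (eq_bigr (fun J : 'I__ => g J v)); last first.
      move=> J _; apply: late; apply/orP.
      have [?|vJ] := leqP (d J + r J) (size v); [by left|right].
      by rewrite ltnNge; apply/negP => dv; apply: none; exists J; rewrite dv.
    over.
  by rewrite sumr_const card_mx -mulr_natl kF_natX.
have J0v : (J0 < (size v).+1)%N by rewrite ltnS (leq_trans (stage_ge _)).
under eq_bigr => a _.
  rewrite /stage_prod (bigD1 (Ordinal J0v)) //= (eq_bigr (fun J : 'I__ => g J v)); last first.
    move=> J; rewrite -val_eqE /= => JJ0; apply: late.
    move: JJ0; rewrite neq_ltn => /orP[/stage_lt JJ0|/stage_lt JJ0].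
      by rewrite (ltnW (leq_trans JJ0 dJ0)).
    by rewrite (ltn_trans vJ0 JJ0) orbT.
  over.
rewrite -mulr_suml density_split; last by move=> q /QP[].
by rewrite -mulrA /stage_prod [in RHS](bigD1 (Ordinal J0v)).
Qed.

Lemma tree_mass_ge0 v : 0 <= tree_mass v.
Proof. by rewrite mulr_ge0 ?stage_prod_ge0 // invr_ge0 exprn_ge0 // ltW. Qed.

Lemma tree_mass_nil : tree_mass [::] = 1.
Proof. by rewrite /tree_mass /stage_prod big_ord0 muln0 expr0 divr1. Qed.

Lemma tree_mass_split v : tree_mass v = \sum_a tree_mass (rcons v a).
Proof.
rewrite /tree_mass; under eq_bigr => a _ do rewrite size_rcons.
rewrite -mulr_suml stage_prod_split stage_prod_size // mulnS exprD.
by field; rewrite !expf_neq0 // gt_eqF.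
Qed.

Lemma qmul_of_digits q (x : nat -> V) j s l : (degq q + s < l)%N ->
  qmul q (of_digits x) j (Negz s) = wcoef q (mkseq x l) j s.
Proof.
move=> ql; apply: eq_bigr => i _; apply: eq_bigr => e _; congr (_ * _) => /=.
have ed : (e <= degq q)%N by rewrite -ltnS (leq_trans (ltn_ord e) (size_degq q i)).
have -> : Negz s - e%:Z = Negz (s + e) by rewrite !NegzE; lia.
rewrite /digit_coef nth_mkseq //; apply: leq_ltn_trans ql; by rewrite addnC leq_add2r.
Qed.

(** If the solutions had degree at most [B], the positive factor of stage [B + 1] would still
    provide a solution in [Q (B + 1)], of degree [d (B + 1) > B]. *)
Lemma tree_mass_Wset (x : nat -> V) : (forall l, 0 < tree_mass (mkseq x l)) ->
  Wset psi (of_digits x).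
Proof.
move=> xpos finW.
have [B BP] : exists B : nat, forall q, distZ R (qmul q (of_digits x)) < psi q -> (degq q <= B)%N.
  have /finite_seqP[w wE] := finW; exists (\max_(q <- w) degq q) => q qW.
  have qw : q \in w by have : [set` w] q by rewrite -wE.
  exact: leq_bigmax_seq.
set J := B.+1; set l := (d J + r J)%N.
have gJ : 0 < g J (mkseq x l).
  rewrite lt_neqAle density_ge0 andbT eq_sym; apply/negP => /eqP g0.
  have := xpos l; rewrite /tree_mass -(@stage_prod_size (maxn l J.+1)) ?size_mkseq ?leq_maxl //.
  rewrite /stage_prod (bigD1 (Ordinal (leq_maxr l J.+1))) //= g0.
  by rewrite !mul0r ltxx.
have [|q qQ qs] := density_gt0 _ gJ; first by rewrite size_mkseq.
have [_ qd qpsi] := QP qQ.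
have : (degq q <= B)%N.
  (* The vanishing of [r J] digits gives distance at most [k^-(r J + 1)], one power to spare for the
     strict inequality. *)
  apply: BP; apply: lt_le_trans qpsi; apply: (@le_lt_trans _ _ (k ^ (- (r J).+1%:Z))).
    apply: distZ_le => j [s|s] // rs _; have sr : (s < r J)%N by move: rs; rewrite NegzE; lia.
    rewrite (@qmul_of_digits _ _ _ _ l) ?qd ?ltn_add2l //.
    by apply/eqP; exact: (forallP (forallP qs j) (Ordinal sr)).
  by rewrite exprnN ltr_eXz2l // ltrN2 ltz_nat.
by rewrite qd leqNgt (leq_ltn_trans _ (stage_ge J)) // .
Qed.

Variables (N : nat -> nat) (tau : R).
Hypothesis N0 : N 0 = 0%N.
Hypothesis NS : forall J, N J.+1 = (N J + 2 * (r J * n))%N.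
Hypothesis tau_ge0 : 0 <= tau.
Hypothesis moment : forall J l, (d J <= l)%N ->
  k ^+ N J * \sum_(v <- words V l) density R (d J) (r J) (Q J) v ^+ 2 <=
  k ^+ (l * m * n) * k `^ (tau * l%:R).

Lemma stage_prod_bound M v : stage_prod M v ^+ 2 <= k ^+ N M.
Proof.
elim: M => [|M IHM]; first by rewrite /stage_prod big_ord0 expr1n N0 expr0.
rewrite /stage_prod big_ord_recr /= -/(stage_prod M v) exprMn NS exprD.
apply: ler_pM; rewrite ?sqr_ge0 // mulnC exprM.
by apply: lerXn2r; rewrite ?nnegrE ?density_ge0 ?exprn_ge0 ?(ltW k0) // density_le.
Qed.

(** At depth [l] let [J] be the last stage begun. The earlier factors are bounded pointwise by
    [stage_prod_bound], and the hypothesis [moment] on stage [J] absorbs that bound. *)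
Lemma tree_energy l : \sum_(v <- words V l) stage_prod (size v) v ^+ 2 <=
  k ^+ (l * m * n) * k `^ (tau * l%:R).
Proof.
have [ld|dl] := ltnP l (d 0).
  rewrite (eq_big_seq (fun=> 1)) => [|v]; last first.
    rewrite mem_words => /eqP vl; rewrite (stage_prod_early (M' := 0)) //; last by rewrite vl ltnW.
    by rewrite /stage_prod big_ord0 expr1n.
  rewrite big_words_ffun sumr_const card_ffun card_mx card_ord -expnM kF_natX.
  rewrite [(m * n * l)%N]mulnC mulnA ler_peMr ?exprn_ge0 ?(ltW k0) //.
  by apply: (@le_trans _ _ (k `^ 0)); [rewrite powRr0|apply: ler_powR; rewrite ?(ltW k1) // mulr_ge0].
have ex : exists J, (d J <= l)%N by exists 0%N.
have bd J : (d J <= l)%N -> (J <= l)%N by apply: leq_trans; exact: stage_ge.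
case: (ex_maxnP ex bd) => J dJ Jmax.
apply: le_trans (moment dJ); rewrite mulr_sumr !big_seq; apply: ler_sum => v.
rewrite mem_words => /eqP vl.
have -> : stage_prod (size v) v = stage_prod J.+1 v.
  rewrite -(@stage_prod_size (maxn (size v) J.+1)) ?leq_maxl //.
  apply: stage_prod_early; first exact: leq_maxr.
  by rewrite vl leqNgt; apply/negP => /ltnW /Jmax; rewrite ltnn.
rewrite /stage_prod big_ord_recr /= -/(stage_prod J v) exprMn ler_wpM2r ?sqr_ge0 //.
exact: stage_prod_bound.
Qed.

(** Level [l] contributes at most [k^(-2mnl) * k^(mnl + tau l) * k^(sl)], a term of a convergent
    geometric series. *)
Lemma tree_energy_sum (s : R) L : tau + s < (m * n)%:R ->
  \sum_(l < L) \sum_(v <- words V l) tree_mass v ^+ 2 / (k ^- l) `^ s <=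
  (1 - k `^ (tau + s - (m * n)%:R))^-1.
Proof.
move=> taus; set z := k `^ _.
have z01 : 0 <= z < 1.
  rewrite powR_ge0 /= /z -opprB powRN invf_lt1 ?powR_gt0 //.
  by rewrite powR_gt1 // subr_gt0.
apply: le_trans (geo_sum_le L z01); apply: ler_sum => l _.
have kl : 0 < k ^+ (m * n * l) by rewrite exprn_gt0.
have ks : (k ^- l) `^ s = (k `^ (s * l%:R))^-1.
  rewrite -powR_invn ?(ltW k0) // -powRrM -powRN; congr (k `^ _).
  by rewrite mulNr mulrC.
rewrite ks invrK.
rewrite (eq_big_seq (fun v => k ^- (m * n * l) ^+ 2 * k `^ (s * l%:R) * stage_prod (size v) v ^+ 2)); last first.
  move=> v; rewrite mem_words => /eqP vl; rewrite /tree_mass vl exprMn; ring.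
rewrite -mulr_sumr; apply: le_trans (ler_wpM2l _ (tree_energy l)) _.
  by rewrite mulr_ge0 ?powR_ge0 // sqr_ge0.
have -> : (l * m * n = m * n * l)%N by rewrite -mulnA mulnC.
have -> : z ^+ l = k `^ (tau * l%:R) * k `^ (s * l%:R) / k ^+ (m * n * l).
  rewrite -powR_mulrn ?powR_ge0 // -powRrM mulrBl mulrDl -natrM.
  by rewrite powRB ?(gt_eqF k0) ?implybT // powRD ?(gt_eqF k0) ?implybT // powR_mulrn ?(ltW k0).
by rewrite le_eqVlt; apply/orP; left; apply/eqP; field; rewrite expf_neq0 // gt_eqF.
Qed.

End Product.

(** * Choice of the stages and the lower bound *)

Section LowerBound.
Variables (F : finFieldType) (R : realType) (m n : nat).
Variable psi : 'rV[{poly F}]_m -> R.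
Local Notation k := (kF F R).
Hypothesis psi_val : forall q, psi q = 0 \/ exists r : int, psi q = k ^ r.
Hypothesis psi_bdd : exists B : R, forall q, psi q <= B.
Hypothesis psi_pos : ~ finite_set [set q | 0 < psi q].
Local Notation eta := (@eta_psi F R m n psi).
Local Notation V := 'M[F]_(m, n).

Lemma good_stage (e tau : R) (K D : nat) :
  e = 0 \/ 0 < e < eta -> e <= n%:R -> n%:R - e < tau ->
  exists d r Q, [/\ (D <= d)%N, (0 < size Q)%N,
    forall q, q \in Q -> [/\ q != 0, degq q = d & k ^- r <= psi q] &
    forall l, (d <= l)%N ->
      k ^+ K * \sum_(v <- words V l) density R d r Q v ^+ 2 <=
      k ^+ (l * m * n) * k `^ (tau * l%:R)].
Proof.
move=> eeta en ntau; have k1 := kF_gt1 F R; have k0 := kF_gt0 F R.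
have e0 : 0 <= e by case: eeta => [->//|/andP[/ltW]].
(* Half of the slack in [n - e < tau]: one factor [y ^+ (d + t)] serves the divisor bound, a second
   one the constants [k ^+ K * (1 + C)]. *)
pose eps := (tau - (n%:R - e)) / 2.
have eps0 : 0 < eps by rewrite divr_gt0 // subr_gt0.
pose y := k `^ eps; have y1 : 1 < y by exact: powR_gt1.
have y0 : 0 < y by exact: lt_trans ltr01 y1.
have [C C0 divC] := divisor_bound F y1.
have [D' D'P] : exists D' : nat, k ^+ K * (1 + C) <= y ^+ D'.
  have x0 : 0 < (k ^+ K * (1 + C)) by rewrite mulr_gt0 ?exprn_gt0 // ltr_wpDr.
  have [z [z0 zP]] := kF_powR_small x0 eps0 ltr01.
  have [D' D'z] := kF_small F z0; exists D'.
  have kD0 : 0 < k ^- D' by rewrite invr_gt0 exprn_gt0.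
  have := zP _ (ltW kD0) D'z.
  have -> : (k ^- D') `^ eps = y ^- D'.
    rewrite -powR_invn ?(ltW k0) // -powRrM mulrC powRrM -/y powR_invn //.
    exact: ltW.
  by rewrite ler_pdivrMr ?exprn_gt0 // mul1r.
have [d [r [Q [Dd uQ Q0 QP Qe]]]] := good_scales psi_val psi_bdd psi_pos eeta (maxn D D').
exists d, r, Q; split=> //; first exact: leq_trans (leq_maxl _ _) Dd.
move=> l dl; set t := minn (l - d) r.
pose Dv := Num.truncn (C * y ^+ (d + t)).
have Cy0 : 0 <= C * y ^+ (d + t) by rewrite mulr_ge0 // exprn_ge0 // ltW.
have DvP : Dv%:R <= C * y ^+ (d + t) by rewrite truncn_le.
have div (f : {poly F}) : f != 0 -> (size f <= d + t)%N ->
    forall s, uniq s -> all (fun h => h %| f) s -> (size s <= Dv)%N.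
  move=> f0 fs s us sd; rewrite -ltnS -(ltr_nat R).
  apply: le_lt_trans (truncnS_gt _); apply: le_trans (divC f f0 s us sd) _.
  by rewrite ler_wpM2l // ler_weXn2l ?(ltW y1) // (leq_trans (leq_pred _)).
have QP' q : q \in Q -> q != 0 /\ degq q = d by move=> /QP[].
have mom := @second_moment F R m n d r l Dv Q dl Q0 uQ QP' div; rewrite -/t in mom.
apply: le_trans (ler_wpM2l (exprn_ge0 K (ltW k0)) mom) _.
rewrite mulrCA; apply: ler_wpM2l; first by rewrite exprn_ge0 // ltW.
set Nq : R := (size Q)%:R in Qe *.
have Nq0 : 0 < Nq by rewrite ltr0n.
pose X := k `^ ((n%:R - e) * (d + t)%:R).
have pX : 1 <= X.
  apply: (@le_trans _ _ (k `^ 0)); first by rewrite powRr0.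
  by apply: ler_powR; rewrite ?(ltW k1) // mulr_ge0 // subr_ge0.
(* The richness of [Q], weakened from [r] to [t <= r], says that [Nq] is at least
   [k^((t + d)e - dn)]. *)
have ktn : k ^+ (t * n) <= Nq * X.
  have {}Qe : k `^ ((t + d)%:R * e) <= Nq * k ^+ (d * n).
    apply: le_trans Qe; apply: ler_powR; rewrite ?(ltW k1) //.
    by rewrite ler_wpM2r // ler_nat leq_add2r geq_minr.
  have -> : Nq * X = Nq * k ^+ (d * n) * (k ^+ (t * n) / k `^ ((t + d)%:R * e)).
    rewrite -mulrA; congr (_ * _); rewrite /X mulrBl.
    rewrite powRB ?(gt_eqF k0) ?implybT // -natrM powR_mulrn ?(ltW k0) //.
    by rewrite mulrA -exprD -mulnDl mulnC [e * _]mulrC [(t + d)%N]addnC.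
  by rewrite mulrCA ler_peMr ?exprn_ge0 ?(ltW k0) // ler_pdivlMr ?powR_gt0 // mul1r.
have yX : 1 <= y ^+ (d + t) * X by rewrite mulr_ege1 // exprn_ege1 // ltW.
have bound : 1 + k ^+ (t * n) * Dv%:R / Nq <= (1 + C) * (y ^+ (d + t) * X).
  rewrite mulrDl mul1r lerD // ler_pdivrMr //.
  apply: le_trans (ler_pM _ _ ktn DvP) _; rewrite ?exprn_ge0 ?(ltW k0) //.
  by rewrite le_eqVlt; apply/orP; left; apply/eqP; ring.
apply: le_trans (ler_wpM2l (exprn_ge0 K (ltW k0)) bound) _; rewrite (mulrA (k ^+ K) (1 + C)).
apply: (@le_trans _ _ (y ^+ (d + t) * (y ^+ (d + t) * X))).
  apply: ler_wpM2r; first exact: le_trans ler01 yX.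
  apply: le_trans D'P _.
  rewrite ler_weXn2l ?(ltW y1) //; apply: leq_trans (leq_addr _ _).
  by apply: leq_trans Dd; exact: leq_maxr.
have -> : y ^+ (d + t) * (y ^+ (d + t) * X) = k `^ (tau * (d + t)%:R).
  rewrite -!powR_mulrn ?(ltW y0) // -!powRrM /X.
  rewrite -!powRD ?(gt_eqF k0) ?implybT //; congr (k `^ _).
  by rewrite /eps; field.
apply: ler_powR; rewrite ?(ltW k1) // ler_wpM2l //.
  by apply: ltW; apply: le_lt_trans ntau; rewrite subr_ge0.
rewrite ler_nat; apply: leq_trans (leq_add (leqnn d) (geq_minl _ _)) _; by rewrite subnKC.
Qed.

Lemma not_coverable_Wset (e s' : R) :
  e = 0 \/ 0 < e < eta -> e <= n%:R -> 0 <= s' -> s' < (m * n)%:R - n%:R + e ->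
  exists delta eps, [/\ 0 < delta, 0 < eps &
    ~ coverable (@distM F R m n) delta s' (@Wset F R m n psi) eps%:E].
Proof.
(* A third of the gap: one share goes to [tau], one to [s], and the last keeps [tau + s] below
   [mn]. *)
move=> eeta en s'0 s'lt; pose rho := ((m * n)%:R - n%:R + e - s') / 3.
have rho0 : 0 < rho by rewrite divr_gt0 // subr_gt0.
pose tau := n%:R - e + rho; pose s := s' + rho.
have ntau : n%:R - e < tau by rewrite ltrDl.
have tau0 : 0 <= tau by rewrite addr_ge0 ?subr_ge0 // ltW.
have s's : s' < s by rewrite ltrDl.
have tsmn : tau + s < (m * n)%:R.
  have : 3 * rho = (m * n)%:R - n%:R + e - s' by rewrite /rho; field.
  by move=> h; rewrite /tau /s -subr_gt0; move: rho0; lra.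
have /choice[st stP] : forall ND : nat * nat, exists dr : nat * nat * seq 'rV[{poly F}]_m,
    [/\ (ND.2 <= dr.1.1)%N, (0 < size dr.2)%N,
    forall q, q \in dr.2 -> [/\ q != 0, degq q = dr.1.1 & k ^- dr.1.2 <= psi q] &
    forall l, (dr.1.1 <= l)%N ->
      k ^+ ND.1 * \sum_(v <- words V l) density R dr.1.1 dr.1.2 dr.2 v ^+ 2 <=
      k ^+ (l * m * n) * k `^ (tau * l%:R)].
  move=> [K D]; have [d [r [Q h]]] := good_stage K D eeta en ntau.
  by exists (d, r, Q).
(* The state holds the exponent bounding the square of the product of all earlier stages, and the
   least degree allowed for the next stage. *)
pose next (ND : nat * nat) : nat * nat :=
  let dr := st ND in ((ND.1 + 2 * (dr.1.2 * n))%N, (dr.1.1 + dr.1.2).+1).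
pose state J := iter J next (0%N, 0%N).
pose d J := (st (state J)).1.1; pose r J := (st (state J)).1.2; pose Q J := (st (state J)).2.
have d_lt J : (d J + r J < d J.+1)%N by have [] := stP (state J.+1).
have Q_gt0 J : (0 < size (Q J))%N by have [] := stP (state J).
have QP J q : q \in Q J -> [/\ q != 0, degq q = d J & k ^- r J <= psi q].
  by have [_ _ h _] := stP (state J); exact: h.
have moment J l : (d J <= l)%N ->
  k ^+ (state J).1 * \sum_(v <- words V l) density R (d J) (r J) (Q J) v ^+ 2 <=
  k ^+ (l * m * n) * k `^ (tau * l%:R).
  by have [_ _ _ h] := stP (state J); exact: h.
have zlt1 : k `^ (tau + s - (m * n)%:R) < 1.
  by rewrite -opprB powRN invf_lt1 ?powR_gt0 ?kF_gt0 // powR_gt1 ?kF_gt1 // subr_gt0.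
apply: (@not_coverable_tree F R m n _ (tree_mass R d r Q) s s'
  (1 - k `^ (tau + s - (m * n)%:R))^-1) => //.
- exact: tree_mass_ge0.
- exact: (tree_mass_split d_lt Q_gt0 QP).
- exact: tree_mass_nil.
- by rewrite invr_gt0 subr_gt0.
- move=> L; exact: (@tree_energy_sum F R m n d r Q d_lt Q_gt0 (fun J => (state J).1) tau erefl
    (fun=> erefl) tau0 moment s L tsmn).
- move=> x; exact: (tree_mass_Wset d_lt Q_gt0 QP).
Qed.

End LowerBound.

(** * The dimension formula *)

Unset Implicit Arguments.

Theorem theorem2 (F : finFieldType) (R : realType) (m n : nat)
    (psi : 'rV[{poly F}]_m -> R)
    (psi_val : forall q, psi q = 0 \/ exists r : int, psi q = kF F R ^ r)
    (psi_bdd : exists B : R, forall q, psi q <= B)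
    (psi_pos : ~ finite_set [set q | 0 < psi q]) :
  dimH (@distM F R m n) (@Wset F R m n psi)
  = ((n%:R * (m%:R - 1) + Num.min (@eta_psi F R m n psi) n%:R)%:E)%E.
Proof.
(* For [m = 0] there is only one vector, so [psi] could not be positive infinitely often. *)
have m0 : (0 < m)%N.
  rewrite lt0n; apply/eqP => m0; subst m; apply: psi_pos.
  by apply: (@sub_finite_set _ _ [set 0]) => // q _ /=; apply/rowP => -[].
set eta := eta_psi _ _; set M := Num.min eta n%:R.
have eta0 : 0 <= eta := eta_ge0 n psi_val psi_bdd psi_pos.
have M0 : 0 <= M by rewrite le_min eta0 ler0n.
have m1E : (m.-1 * n)%:R = n%:R * (m%:R - 1) :> R.
  by rewrite natrM mulrC -subn1 natrB.
have mnE : n%:R * (m%:R - 1) = (m * n)%:R - n%:R :> R.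
  by rewrite natrM; ring.
have T0 : 0 <= n%:R * (m%:R - 1) + M by rewrite -m1E addr_ge0.
apply/eqP; rewrite eq_le; apply/andP; split.
  apply/lee_addgt0Pr => eps eps0; rewrite -EFinD.
  have s0 : 0 <= n%:R * (m%:R - 1) + M + eps by rewrite addr_ge0 // ltW.
  apply: dimH_le => // delta c delta0 c0.
  (* If the minimum is [eta], the tail of a convergent series gives the cover; if it is [n], covers
     of the whole space suffice. *)
  have [etan|neta] := leP eta n%:R.
    have ME : M = eta by exact/min_idPl.
    have [e0 [e00 e0lt fin]] : exists e0, [/\ 0 < e0, e0 < eta + eps &
        (\esum_(q in [set q : 'rV[{poly F}]_m | q != 0%R]) (eta_term n psi e0 q)%:E < +oo)%E].
      by apply: eta_lt => //; rewrite ltrDl.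
    have [B psiB] := psi_bdd.
    apply: (coverable_eta psi_val m0 psiB e00 s0 _ fin delta0 c0).
    rewrite m1E ME (_ : _ - _ = eta + eps); first exact: ltW.
    by ring.
  have ME : M = n%:R by exact/min_idPr/ltW.
  apply: coverable_large => //.
  by rewrite ME mnE subrK ltrDl.
apply: le_dimH => s' s'0 s'T; rewrite mnE in s'T.
(* For [M > 0] an exponent [e] fits strictly between [Num.max x 0] and [M], so that [0 < e < eta].
   For [M = 0] there is no room, and [e = 0] is used. *)
have [Mpos|Mle] := ltP 0 M.
  pose x := s' - ((m * n)%:R - n%:R).
  have xM : Num.max x 0 < M by rewrite gt_max Mpos andbT ltrBlDl.
  pose e := (Num.max x 0 + M) / 2.
  have mid : Num.max x 0 < e < M.
    apply/andP; split; first by rewrite ltr_pdivlMr // mulr_natr mulr2n ltrD2l.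
    by rewrite ltr_pdivrMr // mulr_natr mulr2n ltrD2r.
  move: mid; rewrite gt_max lt_min => /andP[/andP[xe e0] /andP[eeta en]].
  apply: (@not_coverable_Wset F R m n psi psi_val psi_bdd psi_pos e) => //.
  - by right; rewrite e0.
  - exact: ltW.
  - by rewrite -ltrBlDl.
apply: (@not_coverable_Wset F R m n psi psi_val psi_bdd psi_pos 0) => //; first by left.
by apply: lt_le_trans s'T _; rewrite lerD2l.
Qed.
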